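(* (a) Let $K$ be a nonempty perfect compact metric space. Then $C(K)$ contains a closed linear subspace that is isomorphic to $\ell_1$ and is not poor in $C(K)$. (b) Let $(\Omega,\Sigma,\mu)$ be a finite measure space with $\mu$ non-atomic and $\mu(\Omega)>0$ such that $L_1(\Omega,\Sigma,\mu)$ is separable. Then $L_1(\Omega,\Sigma,\mu)$ contains a closed linear subspace that is isomorphic to $\ell_1$ and is not poor in $L_1(\Omega,\Sigma,\mu)$.
   Context: All Banach spaces are real. A Banach space $X$ has the Daugavet property if $\|\mathrm{Id}+T\|=1+\|T\|$ for every rank-one bounded linear operator $T\colon X\to X$. If $X$ has the Daugavet property, a closed linear subspace $Z\subset X$ is called poor (in $X$) if the quotient $X/\tilde Z$ has the Daugavet property for every closed linear subspace $\tilde Z\subset Z$. A compact space is perfect if it has no isolated points. The spaces $C(K)$ ($K$ perfect compact Hausdorff, sup norm) and $L_1(\Omega,\Sigma,\mu)$ ($\mu$ non-atomic) are known to have the Daugavet property. ''Isomorphic'' means linearly homeomorphic. *)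

(* Defs.v *)
From HB Require Import structures.
From mathcomp Require Import all_boot all_order all_algebra generic_quotient.
From mathcomp Require Import all_classical all_reals all_analysis.
From mathcomp Require Import measurable_realfun.

Set Implicit Arguments.
Unset Strict Implicit.
Unset Printing Implicit Defensive.

Import Order.TTheory GRing.Theory Num.Theory.
Import numFieldNormedType.Exports.

Local Open Scope classical_set_scope.
Local Open Scope ring_scope.
Local Open Scope quotient_scope.

(* The norms below make C(K), L_1(mu), l_1 and X/Z normed modules; their
   completeness is not needed to state the Daugavet property. *)

Record closedSubspace (R : realType) (X : normedModType R) := ClosedSubspace {
  subspace_set :> set X ;
  subspace_closed : closed subspace_set ;
  subspace_submod : submod_closed (mem subspace_set)
}.

Section quotient_space.
Context (R : realType) (X : normedModType R) (S : closedSubspace X).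
Local Notation Z := (subspace_set S).

Let Z0 : Z 0.
Proof. by have [] := subspace_submod S; rewrite inE. Qed.

Let ZL a x y : Z x -> Z y -> Z (a *: x + y).
Proof.
by move=> Zx Zy; have [_ /(_ a x y)] := subspace_submod S; rewrite !inE; exact.
Qed.

Let ZD x y : Z x -> Z y -> Z (x + y).
Proof. by move=> Zx Zy; rewrite -[x]scale1r; exact: ZL. Qed.

Let ZZ a x : Z x -> Z (a *: x).
Proof. by move=> Zx; rewrite -[_ *: _]addr0; exact: ZL. Qed.

Let ZN x : Z x -> Z (- x).
Proof. by move=> Zx; rewrite -scaleN1r; exact: ZZ. Qed.

Definition quot_rel (x y : X) : bool := `[< Z (x - y) >].

Let quot_rel_refl : reflexive quot_rel.
Proof. by move=> x; apply/asboolP; rewrite subrr. Qed.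

Let quot_rel_sym : symmetric quot_rel.
Proof.
by move=> x y; apply/idP/idP => /asboolP h; apply/asboolP;
  rewrite -opprB; exact: ZN.
Qed.

Let quot_rel_trans : transitive quot_rel.
Proof.
move=> y x z /asboolP xy /asboolP yz; apply/asboolP.
by rewrite -(subrKA y); exact: ZD.
Qed.

Canonical quot_rel_equiv :=
  EquivRel quot_rel quot_rel_refl quot_rel_sym quot_rel_trans.

Definition quotSpace : Type := {eq_quot quot_rel}.
HB.instance Definition _ := Choice.on quotSpace.
HB.instance Definition _ := EqQuotient.on quotSpace.

Lemma quot_eqP (x y : X) : \pi_quotSpace x = \pi_quotSpace y <-> Z (x - y).
Proof.
by split=> [/eqmodP/asboolP//|h]; apply/eqmodP/asboolP.
Qed.

Let Zrepr x : Z (repr (\pi_quotSpace x) - x).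
Proof. by apply/quot_eqP; rewrite reprK. Qed.

Let piP p : exists x, p = \pi_quotSpace x.
Proof. by exists (repr p); rewrite reprK. Qed.

Definition quot_add (p q : quotSpace) := \pi_quotSpace (repr p + repr q).
Definition quot_opp (p : quotSpace) := \pi_quotSpace (- repr p).
Definition quot_scale (a : R) (p : quotSpace) := \pi_quotSpace (a *: repr p).

Lemma quot_addE x y :
  quot_add (\pi_quotSpace x) (\pi_quotSpace y) = \pi_quotSpace (x + y).
Proof. by apply/quot_eqP; rewrite opprD addrACA; apply: ZD. Qed.

Lemma quot_oppE x : quot_opp (\pi_quotSpace x) = \pi_quotSpace (- x).
Proof. by apply/quot_eqP; rewrite -opprD; apply: ZN. Qed.

Lemma quot_scaleE a x : quot_scale a (\pi_quotSpace x) = \pi_quotSpace (a *: x).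
Proof. by apply/quot_eqP; rewrite -scalerBr; apply: ZZ. Qed.

Let quot_addA : associative quot_add.
Proof.
move=> p q r; have [x ->] := piP p; have [y ->] := piP q.
have [z ->] := piP r; by rewrite !quot_addE addrA.
Qed.

Let quot_addC : commutative quot_add.
Proof. move=> p q; have [x ->] := piP p; have [y ->] := piP q; by rewrite !quot_addE addrC. Qed.

Let quot_add0 : left_id (\pi_quotSpace 0) quot_add.
Proof. by move=> p; have [x ->] := piP p; rewrite quot_addE add0r. Qed.

Let quot_addN : left_inverse (\pi_quotSpace 0) quot_opp quot_add.
Proof. by move=> p; have [x ->] := piP p; rewrite quot_oppE quot_addE addNr. Qed.

HB.instance Definition _ := GRing.isZmodule.Build quotSpace
  quot_addA quot_addC quot_add0 quot_addN.

Let quot_scaleA a b v : quot_scale a (quot_scale b v) = quot_scale (a * b) v.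
Proof. by have [x ->] := piP v; rewrite !quot_scaleE scalerA. Qed.

Let quot_scale1 : left_id 1 quot_scale.
Proof. by move=> p; have [x ->] := piP p; rewrite quot_scaleE scale1r. Qed.

Let quot_scaleDr : right_distributive quot_scale +%R.
Proof.
move=> a p q; have [x ->] := piP p; have [y ->] := piP q.
by rewrite /GRing.add/= quot_addE !quot_scaleE quot_addE scalerDr.
Qed.

Let quot_scaleDl v : {morph quot_scale^~ v : a b / a + b}.
Proof.
move=> a b; have [x ->] := piP v.
by rewrite !quot_scaleE [in RHS]/GRing.add/= quot_addE scalerDl.
Qed.

HB.instance Definition _ := GRing.Zmodule_isLmodule.Build R quotSpace
  quot_scaleA quot_scale1 quot_scaleDr quot_scaleDl.

Definition quot_norm (p : quotSpace) : R :=
  inf [set `|x| | x in [set x : X | \pi_quotSpace x = p]].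

Let quot_norm_lb p :
  has_inf [set `|x| | x in [set x : X | \pi_quotSpace x = p]].
Proof.
split; first by exists `|repr p|, (repr p) => //=; rewrite reprK.
by exists 0 => _ [x _ <-].
Qed.

Let quot_norm_le x : quot_norm (\pi_quotSpace x) <= `|x|.
Proof. by apply: ge_inf; [case: (quot_norm_lb (\pi_quotSpace x))|exists x]. Qed.

Let quot_norm_adh p (e : R) : 0 < e ->
  exists2 x : X, \pi_quotSpace x = p & `|x| < quot_norm p + e.
Proof.
by move=> /inf_adherent/(_ (quot_norm_lb p))[_ [x xp <-] h]; exists x.
Qed.

Let quot_normD p q : quot_norm (p + q) <= quot_norm p + quot_norm q.
Proof.
apply/ler_addgt0Pr => e e0.
have [x <- xp] := quot_norm_adh p (divr_gt0 e0 (ltr0n R 2)).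
have [y <- yq] := quot_norm_adh q (divr_gt0 e0 (ltr0n R 2)).
rewrite [X in quot_norm X]quot_addE (le_trans (quot_norm_le _))//.
rewrite (le_trans (ler_normD _ _))// [in leRHS](splitr e) addrACA.
by rewrite lerD// ltW.
Qed.

Let quot_norm_ge0 p : 0 <= quot_norm p.
Proof. by apply: lb_le_inf; [case: (quot_norm_lb p)|move=> _ [x _ <-]]. Qed.

Let quot_norm0 : quot_norm 0 = 0.
Proof.
apply/eqP; rewrite eq_le quot_norm_ge0 andbT.
by rewrite (le_trans (quot_norm_le 0))// normr0.
Qed.

Let quot_normZ_le (a : R) p : quot_norm (a *: p) <= `|a| * quot_norm p.
Proof.
have [->|a0] := eqVneq a 0; first by rewrite scale0r normr0 mul0r quot_norm0.
have a0' : 0 < `|a| by rewrite normr_gt0.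
apply/ler_addgt0Pr => e e0.
have [x <- xp] := quot_norm_adh p (divr_gt0 e0 a0').
rewrite [X in quot_norm X]quot_scaleE (le_trans (quot_norm_le _))//.
rewrite normrZ (le_trans (ler_wpM2l (normr_ge0 _) (ltW xp)))//.
by rewrite mulrDr mulrCA divff ?mulr1// gt_eqF.
Qed.

Let quot_normZ (a : R) p : quot_norm (a *: p) = `|a| * quot_norm p.
Proof.
have [->|a0] := eqVneq a 0; first by rewrite scale0r normr0 mul0r quot_norm0.
apply/eqP; rewrite eq_le quot_normZ_le/=.
rewrite -ler_pdivlMl ?normr_gt0// -normfV.
by rewrite -[leLHS](congr1 quot_norm (scalerK a0 p)); exact: quot_normZ_le.
Qed.

Let quot_norm_eq0 p : quot_norm p = 0 -> p = 0.
Proof.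
have [x ->] := piP p => px0; apply/quot_eqP; rewrite subr0.
rewrite (closure_id Z).1; last exact: subspace_closed.
move=> B /nbhs_ballP[e /= e0 xB].
have [y /quot_eqP yx ye] := quot_norm_adh (\pi_quotSpace x) e0.
exists (x - y); split; first by rewrite -opprB; exact: ZN.
by apply: xB; rewrite -ball_normE /ball_/= subKr -[e]add0r -px0.
Qed.

HB.instance Definition _ := Lmodule_isNormed.Build R quotSpace
  quot_normD quot_normZ quot_norm_eq0.

End quotient_space.

Section continuous_functions.
Context (R : realType) (K : topologicalType) (cK : compact [set: K]).

Definition CK of compact [set: K] : Type := continuousType K R.
Local Notation C := (CK cK).

Definition CK_pred : {pred K -> R} := mem [set f : K -> R | continuous f].

Section Sub.
Context (f : K -> R) (fP : f \in CK_pred).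
Definition CK_Sub_subproof := @isContinuous.Build K R f (set_mem fP).
#[local] HB.instance Definition _ := CK_Sub_subproof.
Definition CK_Sub : C := [the continuousType K R of f].
End Sub.

Definition CK_val (f : C) : K -> R := (f : continuousType K R).

Let CK_rect (P : C -> Type) :
  (forall f (Pf : f \in CK_pred), P (CK_Sub Pf)) -> forall u, P u.
Proof.
move=> Psub [f [[cf]]].
have Pf : f \in CK_pred by rewrite inE.
by rewrite (_ : cf = set_mem Pf)//; exact: Psub.
Qed.

Let CK_valP f (Pf : f \in CK_pred) : CK_val (CK_Sub Pf) = f.
Proof. by []. Qed.

HB.instance Definition _ := isSub.Build _ _ C CK_rect CK_valP.
HB.instance Definition _ := [Choice of C by <:].

Let CK_submod : submod_closed CK_pred.
Proof.
split; first by rewrite inE/= => x; exact: cvg_cst.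
move=> a f g /[!inE]/= cf cg x.
by apply: cvgD; [apply: cvgZr; exact: cf|exact: cg].
Qed.
HB.instance Definition _ := GRing.isSubmodClosed.Build _ _ CK_pred CK_submod.
HB.instance Definition _ := [SubChoice_isSubLmodule of C by <:].

Definition CK_norm (f : C) : R := sup (range (fun x => `|CK_val f x|)).

Let CK_bounded (f : C) : has_ubound (range (fun x => `|CK_val f x|)).
Proof.
have cf : continuous (fun x => `|CK_val f x|).
  move=> x; apply: (@continuous_comp _ _ _ (CK_val f) Num.norm).
    exact: (@cts_fun _ _ (f : continuousType K R)).
  exact: norm_continuous.
have : compact (range (fun x => `|CK_val f x|)).
  by apply: continuous_compact => //; exact: continuous_subspaceT.
move=> /compact_bounded[M [Mr MB]]; exists (M + 1) => _ [x _ <-].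
by rewrite -[leLHS]normr_id; apply: (MB (M + 1)); [rewrite ltrDl|exists x].
Qed.

Let CK_norm_ub (f : C) x : `|CK_val f x| <= CK_norm f.
Proof. by apply: (ub_le_sup (CK_bounded f)); exists x. Qed.

Let CK_norm_le (f : C) M : 0 <= M -> (forall x, `|CK_val f x| <= M) ->
  CK_norm f <= M.
Proof.
move=> M0 fM; have [K0|/set0P K0] := eqVneq (range (fun x => `|CK_val f x|)) set0.
  by rewrite /CK_norm K0 sup0.
by apply: ge_sup => // _ [x _ <-].
Qed.

Let CK_norm_ge0 (f : C) : 0 <= CK_norm f.
Proof.
have [K0|/set0P[_ [x _ _]]] := eqVneq (range (fun x => `|CK_val f x|)) set0.
  by rewrite /CK_norm K0 sup0.
exact: le_trans (CK_norm_ub f x).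
Qed.

Let CK_normD f g : CK_norm (f + g) <= CK_norm f + CK_norm g.
Proof.
apply: CK_norm_le => [|x]; first by rewrite addr_ge0.
by rewrite (le_trans (ler_normD _ _))// lerD.
Qed.

Let CK_normZ_le (a : R) f : CK_norm (a *: f) <= `|a| * CK_norm f.
Proof.
apply: CK_norm_le => [|x]; first by rewrite mulr_ge0.
by rewrite normrM ler_wpM2l.
Qed.

Let CK_normZ (a : R) f : CK_norm (a *: f) = `|a| * CK_norm f.
Proof.
apply/eqP; rewrite eq_le CK_normZ_le/=.
have [->|a0] := eqVneq a 0; first by rewrite normr0 mul0r.
rewrite -ler_pdivlMl ?normr_gt0// -normfV.
by rewrite -[leLHS](congr1 CK_norm (scalerK a0 f)); exact: CK_normZ_le.
Qed.

Let CK_norm_eq0 f : CK_norm f = 0 -> f = 0.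
Proof.
move=> f0; apply/val_inj/funext => x; apply/eqP.
by rewrite -normr_le0 -f0; exact: CK_norm_ub.
Qed.

HB.instance Definition _ := Lmodule_isNormed.Build R C
  CK_normD CK_normZ CK_norm_eq0.

End continuous_functions.

Section l1.
Context (R : realType).

Definition l1_pred : {pred nat -> R} :=
  mem [set x : nat -> R | cvgn [series `|x n|]_n].

Record l1 := L1seq { l1_seq :> nat -> R ; _ : l1_seq \in l1_pred }.

HB.instance Definition _ := [isSub for l1_seq].
HB.instance Definition _ := [Choice of l1 by <:].

Let l1_submod : submod_closed l1_pred.
Proof.
split.
  rewrite inE/=.
  have -> : (fun n => `|(0 : nat -> R) n|) = 0 :> (nat -> R).
    by apply/funext => n; rewrite normr0.
  rewrite (_ : series 0 = cst 0); first exact: is_cvg_cst.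
  by apply/funext => n; rewrite /series/= big1.
move=> a x y /[!inE]/= cx cy.
apply: (@series_le_cvg _ _ (fun n => `|a| *: `|x n| + `|y n|)) => [n|n|n|].
- exact: normr_ge0.
- by rewrite addr_ge0// mulr_ge0.
- by rewrite (le_trans (ler_normD _ _))// normrM.
- apply: (@is_cvg_seriesD _ (`|a| *: (fun n => `|x n|)) (fun n => `|y n|)) => //.
  exact: is_cvg_seriesZ.
Qed.
HB.instance Definition _ := GRing.isSubmodClosed.Build _ _ l1_pred l1_submod.
HB.instance Definition _ := [SubChoice_isSubLmodule of l1 by <:].

Definition l1_norm (x : l1) : R := limn [series `|x n|]_n.

Let l1_cvg (x : l1) : cvgn [series `|x n|]_n.
Proof. by have := valP x; rewrite inE. Qed.

Let l1_normD x y : l1_norm (x + y) <= l1_norm x + l1_norm y.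
Proof.
rewrite /l1_norm -lim_seriesD//; apply: lim_series_le => //.
- by apply: is_cvg_seriesD; exact: l1_cvg.
- by move=> n; exact: ler_normD.
Qed.

Let l1_normZ (a : R) x : l1_norm (a *: x) = `|a| * l1_norm x.
Proof.
rewrite /l1_norm -[RHS]lim_seriesZ//; congr (limn (series _)).
by apply/funext => n; exact: normrM.
Qed.

Let l1_norm_eq0 x : l1_norm x = 0 -> x = 0.
Proof.
move=> x0; apply/val_inj/funext => n; apply/eqP; rewrite -normr_le0 -x0.
apply: (@le_trans _ _ ([series `|x k|]_k n.+1)).
  by rewrite seriesSr lerDr; apply: sumr_ge0 => k _; exact: normr_ge0.
apply: nondecreasing_cvgn_le; last exact: l1_cvg.
by apply: nondecreasing_series => k _ _; exact: normr_ge0.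
Qed.

HB.instance Definition _ := Lmodule_isNormed.Build R l1
  l1_normD l1_normZ l1_norm_eq0.

End l1.

(* {mfun T >-> R} and {mfun T >-> measurableTypeR R} carry the same
   sigma-algebra on R under different displays; LfunType is built on the former
   and LspaceType on the latter. *)
Section mfun_display.
Context d (T : measurableType d) (R : realType).

Let mfunR_subproof (f : {mfun T >-> measurableTypeR R}) :
  @measurable_fun _ _ T R setT f.
Proof. exact: (@measurable_funPT _ _ _ _ f). Qed.

Definition mfunR (f : {mfun T >-> measurableTypeR R}) : {mfun T >-> R} :=
  HB.pack_for {mfun T >-> R} (f : T -> R)
    (@isMeasurableFun.Build d _ T R f (mfunR_subproof f)).

Let mfun_subproof (f : {mfun T >-> R}) :
  @measurable_fun _ _ T (measurableTypeR R) setT f.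
Proof. exact: (@measurable_funPT _ _ _ _ f). Qed.

Definition mfun_measurableTypeR (f : {mfun T >-> R}) :
    {mfun T >-> measurableTypeR R} :=
  HB.pack_for {mfun T >-> measurableTypeR R} (f : T -> measurableTypeR R)
    (@isMeasurableFun.Build d _ T (measurableTypeR R) f (mfun_subproof f)).

End mfun_display.

Section L1.
Context d (T : measurableType d) (R : realType).
Variable mu : {measure set T -> \bar R}.

Definition L1 : Type := LspaceType1 mu.
Local Notation ty := (LfunType mu (@lexx _ _ 1%E)).
Local Notation Q := {mfun_ mu, T >-> measurableTypeR R}.
Local Notation N f := (fine 'N[mu]_1[EFin \o f])%E.

Let Lnorm_ae (f g : {mfun T >-> R}) : (f : T -> R) = g %[ae mu] ->
  'N[mu]_1[EFin \o f]%E = 'N[mu]_1[EFin \o g]%E.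
Proof.
move=> fg; rewrite !Lnorm1; apply: ae_eq_integral => //.
- have mE : measurable_fun setT (EFin \o f) by exact/measurable_EFinP.
  exact: (measurableT_comp (@abse_measurable R setT) mE).
- have mE : measurable_fun setT (EFin \o g) by exact/measurable_EFinP.
  exact: (measurableT_comp (@abse_measurable R setT) mE).
- by apply: filterS fg => x /= /[apply] ->.
Qed.

Let L1_fun_subproof (f : L1) :
  (mfunR (repr ((f : LspaceType1 mu) : Q)) : T -> R) \in Lfun mu 1.
Proof.
rewrite inE; apply/andP; split; rewrite inE/=.
  exact: (@measurable_funPT _ _ _ _ (mfunR (repr ((f : LspaceType1 mu) : Q)))).
exact: (@Lebesgue_finite _ _ _ _ _ _ (f : LspaceType1 mu)).
Qed.

Definition L1_fun (f : L1) : ty := Lfun_Sub (@lexx _ _ 1%E) (L1_fun_subproof f).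

Let L1_pi (f : ty) : Q := \pi_Q (mfun_measurableTypeR f).

Let reprE (f : ty) : (repr (L1_pi f) : T -> R) = f %[ae mu].
Proof.
have /eqmodP/asboolP : (repr (L1_pi f) = mfun_measurableTypeR f %[mod Q])%qT.
  by rewrite reprK.
exact.
Qed.

Let L1_pi_finite (f : ty) : finite_norm mu 1 (L1_pi f).
Proof.
rewrite /finite_norm.
rewrite (@Lnorm_ae (mfunR (repr (L1_pi f))) f (reprE f)).
exact: (@Lfunction_finite _ _ _ _ _ _ f).
Qed.

Definition L1_class (f : ty) : L1 :=
  HB.pack_for (LspaceType1 mu) (L1_pi f)
    (isFinLebesgue.Build d T R mu 1%E (@lexx _ _ 1%E) (L1_pi f)
       (L1_pi_finite f)).

HB.instance Definition _ := gen_eqMixin L1.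
HB.instance Definition _ := gen_choiceMixin L1.

Lemma L1_classK (f : ty) : (L1_fun (L1_class f) : T -> R) = f %[ae mu].
Proof. exact: reprE. Qed.

Lemma L1_fun_eqP (f g : L1) :
  f = g <-> (L1_fun f : T -> R) = L1_fun g %[ae mu].
Proof.
split=> [->|fg]; first exact: ae_eq_refl.
have {}fg : f = g :> Q.
  by rewrite -[f : Q]reprK -[g : Q]reprK; apply/eqmodP/asboolP.
case: f g fg => [f [[pf]]] [g [[pg]]] /= fg.
by subst g; rewrite (Prop_irrelevance pf pg).
Qed.

Lemma L1_class_eqP (f g : ty) :
  L1_class f = L1_class g <-> (f : T -> R) = g %[ae mu].
Proof.
split=> [fg|fg].
  apply: ae_eq_trans (ae_eq_sym (L1_classK f)) _.
  by rewrite fg; exact: L1_classK.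
apply/L1_fun_eqP; apply: ae_eq_trans (L1_classK f) _.
exact: ae_eq_trans fg (ae_eq_sym (L1_classK g)).
Qed.

Lemma L1_funK : cancel L1_fun L1_class.
Proof. by move=> f; apply/L1_fun_eqP; exact: L1_classK. Qed.

Let classP (p : L1) : exists f, p = L1_class f.
Proof. by exists (L1_fun p); rewrite L1_funK. Qed.

Definition L1_add (p q : L1) := L1_class (L1_fun p + L1_fun q).
Definition L1_opp (p : L1) := L1_class (- L1_fun p).
Definition L1_scale (a : R) (p : L1) := L1_class (a *: L1_fun p).

Lemma L1_addE f g : L1_add (L1_class f) (L1_class g) = L1_class (f + g).
Proof.
apply/L1_class_eqP; move: (L1_classK f) (L1_classK g).
by apply: filterS2 => x /(_ I) fx /(_ I) gx _; congr (_ + _).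
Qed.

Lemma L1_oppE f : L1_opp (L1_class f) = L1_class (- f).
Proof.
apply/L1_class_eqP; move: (L1_classK f).
by apply: filterS => x /(_ I) fx _; congr (- _).
Qed.

Lemma L1_scaleE a f : L1_scale a (L1_class f) = L1_class (a *: f).
Proof.
apply/L1_class_eqP; move: (L1_classK f).
by apply: filterS => x /(_ I) fx _; congr (_ * _).
Qed.

Let L1_addA : associative L1_add.
Proof.
move=> p q r; have [x ->] := classP p; have [y ->] := classP q.
by have [z ->] := classP r; rewrite !L1_addE addrA.
Qed.

Let L1_addC : commutative L1_add.
Proof.
move=> p q; have [x ->] := classP p; have [y ->] := classP q.
by rewrite !L1_addE addrC.
Qed.

Let L1_add0 : left_id (L1_class 0) L1_add.
Proof. by move=> p; have [x ->] := classP p; rewrite L1_addE add0r. Qed.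

Let L1_addN : left_inverse (L1_class 0) L1_opp L1_add.
Proof.
by move=> p; have [x ->] := classP p; rewrite L1_oppE L1_addE addNr.
Qed.

HB.instance Definition _ := GRing.isZmodule.Build L1
  L1_addA L1_addC L1_add0 L1_addN.

Let L1_scaleA a b v : L1_scale a (L1_scale b v) = L1_scale (a * b) v.
Proof. by have [x ->] := classP v; rewrite !L1_scaleE scalerA. Qed.

Let L1_scale1 : left_id 1 L1_scale.
Proof. by move=> p; have [x ->] := classP p; rewrite L1_scaleE scale1r. Qed.

Let L1_scaleDr : right_distributive L1_scale +%R.
Proof.
move=> a p q; have [x ->] := classP p; have [y ->] := classP q.
by rewrite /GRing.add/= L1_addE !L1_scaleE L1_addE scalerDr.
Qed.

Let L1_scaleDl v : {morph L1_scale^~ v : a b / a + b}.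
Proof.
move=> a b; have [x ->] := classP v.
by rewrite !L1_scaleE [in RHS]/GRing.add/= L1_addE scalerDl.
Qed.

HB.instance Definition _ := GRing.Zmodule_isLmodule.Build R L1
  L1_scaleA L1_scale1 L1_scaleDr L1_scaleDl.

Definition L1_norm (p : L1) : R := N (L1_fun p).

Lemma L1_norm_class (f : ty) : L1_norm (L1_class f) = N f.
Proof. by congr fine; apply: Lnorm_ae; exact: L1_classK. Qed.

Let L1_normD p q : L1_norm (p + q) <= L1_norm p + L1_norm q.
Proof.
have [x ->] := classP p; have [y ->] := classP q.
rewrite [X in L1_norm X <= _]L1_addE !L1_norm_class; exact: ler_LnormD.
Qed.

Let L1_normZ (a : R) p : L1_norm (a *: p) = `|a| * L1_norm p.
Proof.
have [x ->] := classP p.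
rewrite [X in L1_norm X = _]L1_scaleE !L1_norm_class.
apply/EFin_inj; rewrite EFinM !finite_norm_fine; exact: LnormZ.
Qed.

Let L1_norm_eq0 p : L1_norm p = 0 -> p = 0.
Proof.
have [x ->] := classP p; rewrite L1_norm_class => x0.
by apply/L1_class_eqP; exact: fine_Lnormr_eq0.
Qed.

HB.instance Definition _ := Lmodule_isNormed.Build R L1
  L1_normD L1_normZ L1_norm_eq0.

End L1.

Definition opnorm (R : realType) (X Y : normedModType R) (f : X -> Y) : R :=
  sup [set `|f x| | x in [set x : X | `|x| <= 1]].

Definition rank_one (R : realType) (X Y : normedModType R) (f : X -> Y) : Prop :=
  exists2 y : Y, y != 0 & range f = range (fun a : R => a *: y).

Definition daugavet (R : realType) (X : normedModType R) : Prop :=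
  forall f : {linear X -> X}, continuous f -> rank_one f ->
    opnorm (fun x => x + f x) = 1 + opnorm f.

(* Z ranges over subspaces of spaces X having the Daugavet property; this is not
   repeated as a conjunct (Z' = 0 already forces it). *)
Definition poor (R : realType) (X : normedModType R)
    (Z : closedSubspace X) : Prop :=
  forall Z' : closedSubspace X, Z' `<=` Z -> daugavet (quotSpace Z').

(* g inverts f on Z; the subspace topology on Z makes f a linear homeomorphism
   from Y onto Z. *)
Definition isomorphic_to_subspace (R : realType) (Y X : normedModType R)
    (Z : closedSubspace X) : Prop :=
  exists (f : {linear Y -> X}) (g : X -> Y),
    [/\ continuous f, range f = Z, cancel f g & {within Z, continuous g}].

Definition separable (T : topologicalType) : Prop :=
  exists2 A : set T, countable A & dense A.

Definition atom d (T : measurableType d) (R : realType)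
    (mu : {measure set T -> \bar R}) (A : set T) : Prop :=
  [/\ measurable A, (0 < mu A)%E &
    forall B, measurable B -> B `<=` A -> mu B = 0 \/ mu (A `\` B) = 0].

Definition nonatomic d (T : measurableType d) (R : realType)
    (mu : {measure set T -> \bar R}) : Prop :=
  forall A, ~ atom mu A.

(* Main.v *)
Require Import Defs.
From HB Require Import structures.
From mathcomp Require Import all_boot all_order all_algebra generic_quotient.
From mathcomp Require Import all_classical all_reals all_analysis.
From mathcomp Require Import measurable_realfun ring lra.

Set Implicit Arguments.
Unset Strict Implicit.
Unset Printing Implicit Defensive.

Import Order.TTheory GRing.Theory Num.Theory.
Import numFieldNormedType.Exports.

Local Open Scope classical_set_scope.
Local Open Scope ring_scope.

(** Both parts come from one construction.  Fix a norm-one functional phi on X,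
    a point x0 with norm(x0) = phi(x0) = 1, and a bounded sequence (u n) in the
    kernel of phi that is equivalent to the unit vector basis of l_1.  Suppose
    that every x that is nearly of norm one and nearly normed by phi lies
    within 7/4 of x0 + u n for some n.  Let Z be the closed span of (u n), a
    copy of l_1.  In X/Z every point of the slice phi > 7/8 of the unit ball is
    then at distance about 7/4 at most from the class y0 of x0, while phi still
    has norm one on X/Z.  Hence the rank-one operator T p = - phi(p) y0, which
    has norm one, satisfies norm(Id + T) <= 15/8 < 2, so X/Z fails the Daugavet
    property and Z is not poor (nonpoor_l1_copy).

    What remains is to find (u n) in each space.  By separability there is a
    sequence (x n) that approximates every x in question; x n - phi(x n) x0
    lies in the kernel of phi and is within a small error of x n - x0 when x n
    is in the slice.  Adding to it a perturbation of norm less than 7/4, with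
    some room to spare, must turn it into an l_1-sequence.

    - In C(K), phi is the evaluation at a point t and x0 is a bump at t.  On a
      region W disjoint from the support of x0, x n is replaced by f n / 4,
      where the functions f n take all sign patterns on W; perfectness of K
      yields them (independent_signs).  Since x0 vanishes near W, this replaces
      a function of norm about 1, not 2, by one of norm 1/4
      (CK_nonpoor_l1_copy).
    - In L_1, phi is the integral over a set E 0, and x0 is the normalized
      indicator of E 0.  The perturbation of the n-th term is the normalized
      indicator of E (n+1), with (E n) disjoint of positive measure
      (nonatomic_disjoint_sets).  A function of the slice has little mass
      outside E 0, so these disjoint bumps survive (L1_nonpoor_l1_copy).

    In both cases the l_1-lower bound is proved by exhibiting, for each sign
    pattern, a norm-one functional that takes values of these signs, bounded
    away from 0, on the u n (sign_separated).  The sums of the l_1-combinations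
    of the u n exist because absolutely summable series converge in C(K)
    (CK_absolutely_summable) and in L_1 (L1_absolutely_summable). *)

(** * Linear maps and the norm of l_1 *)

Lemma linear_bundle (R : pzRingType) (U : lmodType R) (V : zmodType)
    (s : GRing.Scale.law R V) (f : U -> V) :
  linear_for s f -> exists F : {linear U -> V | s}, F = f :> (U -> V).
Proof.
move=> lf.
by exists (HB.pack_for {linear U -> V | s} f (GRing.isLinear.Build R U V s f lf)).
Qed.

Section l1_norm.
Context (R : realType).
Implicit Types a : l1 R.

Lemma l1_cvg a : cvgn [series `|a n|]_n.
Proof. by have := valP a; rewrite inE. Qed.

Lemma l1_partial_le a N : \sum_(0 <= n < N) `|a n| <= `|a|.
Proof.
apply: (nondecreasing_cvgn_le (u_ := [series `|a n|]_n)); last exact: l1_cvg.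
by apply: nondecreasing_series => k _ _; exact: normr_ge0.
Qed.

Lemma l1_norm_le a M :
  (forall N, \sum_(0 <= n < N) `|a n| <= M) -> `|a| <= M.
Proof. by move=> aM; apply: limr_le; [exact: l1_cvg|near=> N; exact: aM].
Unshelve. all: by end_near. Qed.

Lemma l1_of_bounded_partial (f : nat -> R) M :
  (forall N, \sum_(0 <= n < N) `|f n| <= M) ->
  exists a, a = f :> (nat -> R).
Proof.
move=> fM.
have fP : f \in @l1_pred R.
  rewrite inE/=; apply: nondecreasing_is_cvgn.
    by apply: nondecreasing_series => k _ _; exact: normr_ge0.
  by exists M => _ [N _ <-]; exact: fM.
by exists (L1seq fP).
Qed.

Lemma l1_coord_le a n : `|a n| <= `|a|.
Proof.
apply: le_trans (l1_partial_le a n.+1).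
by rewrite big_nat_recr//= lerDr sumr_ge0.
Qed.

End l1_norm.

(** * Sequences equivalent to the unit vector basis of l_1 *)

(** For normed spaces this is equivalent to being a Banach space.  It is the
    form of completeness that the sums of l_1-combinations call for. *)
Definition absolutely_summable (R : realType) (X : normedModType R) : Prop :=
  forall v : nat -> X, cvgn [series `|v n|]_n -> cvgn (series v).

(** The dual form of the estimate
    norm(sum a_n u_n) >= d * sum |a_n|: test the sum against the functional
    given by the signs of the coefficients. *)
Definition sign_separated (R : realType) (X : normedModType R) (d : R)
    (u : nat -> X) : Prop :=
  forall (th : nat -> bool) N, exists psi : {scalar X},
    (forall x, `|psi x| <= `|x|) /\
    (forall i, (i < N)%N -> d <= (-1) ^+ th i * psi (u i)).

Section l1_sequence.
Context (R : realType) (X : normedModType R) (u : nat -> X) (C d : R).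
Hypothesis Xsum : absolutely_summable X.
Hypothesis uC : forall n, `|u n| <= C.
Hypothesis d0 : 0 < d.
Hypothesis lower : sign_separated d u.

Let C0 : 0 <= C. Proof. exact: le_trans (uC 0). Qed.

Definition l1_comb (a : l1 R) : X := limn (series (fun n => a n *: u n)).

Lemma l1_comb_cvg (a : l1 R) : cvgn (series (fun n => a n *: u n)).
Proof.
apply: Xsum; apply: (@series_le_cvg _ _ (C *: (fun n => `|a n|))) => [n|n|n|].
- exact: normr_ge0.
- by rewrite mulr_ge0.
- by rewrite /= normrZ mulrC ler_wpM2r.
- by apply: is_cvg_seriesZ; exact: l1_cvg.
Qed.

Lemma l1_comb_linear : linear l1_comb.
Proof.
move=> c a b; rewrite /l1_comb -limZr; last exact: l1_comb_cvg.
rewrite -limD; [|by apply: is_cvgZr; exact: l1_comb_cvg|exact: l1_comb_cvg].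
congr (limn _); apply/funext => N.
rewrite /series/= [in RHS]/GRing.scale/= [in RHS]/GRing.add/=.
rewrite scaler_sumr -big_split/=; apply: eq_bigr => n _.
by rewrite scalerDl scalerA.
Qed.

Lemma l1_comb_le (a : l1 R) : `|l1_comb a| <= C * `|a|.
Proof.
rewrite -lim_norm; last exact: l1_comb_cvg.
apply: limr_le; first by apply: is_cvg_norm; exact: l1_comb_cvg.
near=> N; rewrite /series/= (le_trans (ler_norm_sum _ _ _))//.
apply: (@le_trans _ _ (C * \sum_(0 <= n < N) `|a n|)); last first.
  by rewrite ler_wpM2l// l1_partial_le.
rewrite mulr_sumr; apply: ler_sum => n _.
by rewrite normrZ mulrC ler_wpM2r.
Unshelve. all: by end_near. Qed.

Lemma l1_partial_lower (a : l1 R) N :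
  d * \sum_(0 <= n < N) `|a n| <= `|series (fun n => a n *: u n) N|.
Proof.
have [psi [psi1 psid]] := lower (fun n => a n < 0) N.
rewrite (le_trans _ (psi1 _))// (le_trans _ (ler_norm _))//.
rewrite /series/= linear_sum/= mulr_sumr !big_mkord; apply: ler_sum => n _.
rewrite scalarZ {2}[a n]realEsign ?num_real// -mulrA mulrCA mulrC ler_wpM2l//.
exact: psid.
Qed.

Lemma l1_comb_lower (a : l1 R) : `|a| <= d^-1 * `|l1_comb a|.
Proof.
apply: l1_norm_le => N; rewrite ler_pdivlMl// -lim_norm; last exact: l1_comb_cvg.
apply: limr_ge; first by apply: is_cvg_norm; exact: l1_comb_cvg.
near=> M; apply: le_trans (l1_partial_lower a M).
rewrite ler_pM2l//; apply: (@nondecreasing_series _ _ predT) => //.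
by near: M; exact: nbhs_infty_ge.
Unshelve. all: by end_near. Qed.

Lemma l1_comb_unit n : range l1_comb (u n).
Proof.
have [|e eE] := @l1_of_bounded_partial R (fun k => (k == n)%:R) 1.
  move=> N; apply: (@le_trans _ _ (\sum_(0 <= k < N) (k == n)%:R)).
    by apply: ler_sum => k _; rewrite ger0_norm ?ler0n.
  rewrite big_mkord -natr_sum lern1; have [nN|Nn] := ltnP n N.
    rewrite (bigD1 (Ordinal nN))//= eqxx big1// => k.
    by rewrite -val_eqE/= => /negPf ->.
  by rewrite big1// => k _; rewrite ltn_eqF// (leq_trans (ltn_ord k)).
exists e => //.

rewrite /l1_comb.
apply: lim_near_cst; first exact: norm_hausdorff.
near=> N.
rewrite /series/= eE big_mkord.
have nN : (n < N)%N by near: N; exact: nbhs_infty_gt.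
rewrite (bigD1 (Ordinal nN))//= eqxx scale1r big1 ?addr0// => k.
by rewrite -val_eqE/= => /negPf ->; rewrite scale0r.
Unshelve. all: by end_near. Qed.

Lemma l1_comb_vanish (phi : {scalar X}) (a : l1 R) :
  (forall x, `|phi x| <= `|x|) -> (forall n, phi (u n) = 0) ->
  phi (l1_comb a) = 0.
Proof.
move=> phi1 phiu; apply/eqP; rewrite -normr_le0; apply/ler_addgt0Pr => e e0.
have := @l1_comb_cvg a => /cvgrPdist_lt/(_ _ e0)[N _ /(_ N (leqnn N))].
rewrite add0r => /ltW; apply: le_trans; apply: le_trans (phi1 _).
rewrite linearB/= [X in _ <= `|_ - X|](_ : _ = 0) ?subr0//.
by rewrite linear_sum/= big1// => n _; rewrite scalarZ phiu mulr0.
Qed.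

Let J_diff a b : `|a - b| <= d^-1 * `|l1_comb a - l1_comb b|.
Proof.
apply: le_trans (l1_comb_lower _) _; rewrite -scaleN1r addrC l1_comb_linear.
by rewrite scaleN1r addrC.
Qed.

Let inv_small (e : R) : 0 < e ->
  exists k : nat, d^-1 * (k.+1%:R^-1 + k.+1%:R^-1) < e.
Proof.
move=> e0; have de : 0 < d * e / 2 by rewrite divr_gt0// mulr_gt0.
have [k _ /(_ k (leqnn k))] := near_infty_natSinv_lt (PosNum de).
move=> /= h; exists k; rewrite ltr_pdivrMl//.
by rewrite [ltRHS](splitr (d * e)) ltrD.
Qed.

(** Coefficients of points J a_k converging to z form a Cauchy sequence in l_1,
    by the lower bound for the synthesis map J.  Their coordinatewise limit f
    is in l_1 once translated by a_0, since f - a_0 has bounded partial sums;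
    this is completeness of l_1, carried out along (a_k). *)
Lemma l1_comb_range_closed : closed (range l1_comb).
Proof.
move=> z zcl.
have /choice[a az] : forall k, exists a, `|z - l1_comb a| < k.+1%:R^-1.
  move=> k; have k0 : 0 < k.+1%:R^-1 :> R by rewrite invr_gt0.
  have [_ [[a _ <-] za]] := zcl _ (nbhsx_ballx z _ k0).
  by exists a; move: za; rewrite -ball_normE.
have adiff k l : `|a k - a l| <= d^-1 * (k.+1%:R^-1 + l.+1%:R^-1).
  apply: le_trans (J_diff _ _) _; rewrite ler_wpM2l ?invr_ge0 ?(ltW d0)//.
  rewrite -(subrKA z) (le_trans (ler_normD _ _))//.
  by rewrite lerD// ltW// distrC.
have acvg n : cvgn (fun k => a k n).
  apply: cauchy_cvg; apply: cauchy_exP => e e0.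
  have [k ke] := inv_small e0; exists (a k n); exists k => // m /= km.
  rewrite -ball_normE/=; apply: le_lt_trans (l1_coord_le (a k - a m) n) _.
  apply: le_lt_trans (adiff _ _) _; apply: le_lt_trans ke.
  rewrite ler_wpM2l ?invr_ge0 ?(ltW d0)// lerD//.
  by rewrite lef_pV2 ?posrE// ler_nat.
pose f n := limn (fun k => a k n).
have fa k N : \sum_(0 <= n < N) `|f n - a k n| <= d^-1 * (k.+1%:R^-1 + k.+1%:R^-1).
  have cN n : `|a l n - a k n| @[l --> \oo] --> `|f n - a k n|.
    by apply: cvg_norm; apply: cvgB; [exact: acvg|exact: cvg_cst].
  have cS : \sum_(0 <= n < N) `|a l n - a k n| @[l --> \oo] -->
            \sum_(0 <= n < N) `|f n - a k n|.
    by apply: cvg_big => [|n _]; [exact: add_continuous|exact: cN].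
  rewrite -(cvg_lim _ cS)//.
  apply: limr_le; first by apply/cvg_ex; eexists; exact: cS.
  near=> l; apply: le_trans (l1_partial_le (a l - a k) N) _.
  apply: le_trans (adiff _ _) _.
  rewrite ler_wpM2l ?invr_ge0 ?(ltW d0)// lerD//.
  by rewrite lef_pV2 ?posrE// ler_nat ltnS; near: l; exact: nbhs_infty_ge.
have [b bE] : exists b : l1 R, b = (fun n => f n - a 0 n) :> (nat -> R).
  by apply: l1_of_bounded_partial => N; exact: fa.
exists (b + a 0) => //; apply/eqP; rewrite -subr_eq0 -normr_le0.
apply/ler_addgt0Pr => e e0; rewrite add0r.
pose D := 1 + C * (d^-1 * 2).
have D0 : 0 < D.
  by rewrite ltr_wpDr// mulr_ge0// mulr_ge0// invr_ge0 ltW.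
have [k _ /(_ k (leqnn k))/= kD] := near_infty_natSinv_lt (PosNum (divr_gt0 e0 D0)).
have akb : `|a k - (b + a 0)| <= d^-1 * (k.+1%:R^-1 + k.+1%:R^-1).
  apply: l1_norm_le => N; rewrite (eq_bigr (fun n => `|f n - a k n|))// => n _.
  have -> : (a k - (b + a 0)) n = a k n - (b n + a 0 n) by [].
  by rewrite bE subrK distrC.
rewrite distrC -(subrKA (l1_comb (a k))) (le_trans (ler_normD _ _))//.
have JB : l1_comb (a k) - l1_comb (b + a 0) = l1_comb (a k - (b + a 0)).
  by rewrite -scaleN1r addrC -l1_comb_linear scaleN1r addrC.
rewrite JB; apply: (@le_trans _ _ (k.+1%:R^-1 * D)); last first.
  by rewrite -ler_pdivlMr// ltW.
rewrite mulrDr mulr1 lerD//; first exact: ltW.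
apply: le_trans (l1_comb_le _) _; rewrite mulrCA ler_wpM2l//.
apply: le_trans akb _.
by rewrite mulrCA ler_wpM2l ?invr_ge0 ?(ltW d0)// mulr_natr mulr2n.
Unshelve. all: by end_near. Qed.

Lemma l1_comb_range_submod : submod_closed (mem (range l1_comb)).
Proof.
split.
  rewrite inE; exists 0 => //.
  by have [J JE] := linear_bundle l1_comb_linear; rewrite -JE linear0.
move=> c x y /[!inE] -[a _ <-] [b _ <-].
by exists (c *: a + b) => //; exact: l1_comb_linear.
Qed.

(** The image of [l1_comb] equals the closed linear span of the sequence. *)
Definition l1_span : closedSubspace X :=
  ClosedSubspace l1_comb_range_closed l1_comb_range_submod.

Lemma l1_span_isomorphic : isomorphic_to_subspace (l1 R) l1_span.
Proof.
have [J JE] := linear_bundle l1_comb_linear.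
pose g x := if pselect (exists a, l1_comb a = x) is left h
            then projT1 (cid h) else 0.
have Jg x : range l1_comb x -> l1_comb (g x) = x.
  move=> [a _ ax]; rewrite /g; case: pselect => [h|]; last by case; exists a.
  by case: cid.
have Jinj a b : l1_comb a = l1_comb b -> a = b.
  move=> ab; apply/eqP; rewrite -subr_eq0 -normr_le0.
  by apply: le_trans (J_diff _ _) _; rewrite ab subrr normr0 mulr0.
exists J, g; rewrite JE; split=> //.
- rewrite -JE; apply: bounded_linear_continuous; apply/bounded_funP => r.
  exists (C * r) => x xr; rewrite JE; apply: le_trans (l1_comb_le _) _.
  exact: ler_wpM2l.
- by move=> a; apply: Jinj; apply: Jg; exists a.
- apply/subspace_continuousP => x Zx; apply/cvgrPdist_lt => e e0.
  rewrite near_withinE; near=> y => Zy.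
  apply: le_lt_trans (J_diff _ _) _; rewrite !Jg// ltr_pdivrMl//.
  by near: y; apply: cvgr_dist_lt; rewrite ?mulr_gt0.
Unshelve. all: by end_near.
Qed.

End l1_sequence.

(** * Quotients without the Daugavet property *)

Section quotient.
Context (R : realType) (X : normedModType R) (Z : closedSubspace X).
Local Notation Q := (quotSpace Z).
Local Open Scope quotient_scope.

Lemma quot_piL (a : R) (x y : X) : \pi_Q (a *: x + y) = a *: \pi_Q x + \pi_Q y.
Proof. by rewrite [RHS]/GRing.add/= [X in quot_add X]quot_scaleE quot_addE. Qed.

Lemma quot_piB (x y : X) : \pi_Q (x - y) = \pi_Q x - \pi_Q y.
Proof. by have [q qE] := linear_bundle quot_piL; rewrite -qE linearB. Qed.

Lemma quot_pi0 (z : X) : subspace_set Z z -> \pi_Q z = 0.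
Proof. by move=> Zz; apply/quot_eqP; rewrite subr0. Qed.

Lemma quot_norm_pi (x : X) : `|\pi_Q x| <= `|x|.
Proof.
by apply: ge_inf; [exists 0 => _ [y _ <-]|exists x].
Qed.

Lemma quot_norm_lift (p : Q) (e : R) : 0 < e ->
  exists2 x, \pi_Q x = p & `|x| < `|p| + e.
Proof.
move=> e0; have [|_ [x xp <-] xe] := @inf_adherent _
  [set `|x| | x in [set x : X | \pi_Q x = p]] e e0; last by exists x.
by split; [exists `|repr p|, (repr p) => //=; rewrite reprK|exists 0 => _ [x _ <-]].
Qed.

(** If the quotient map brings a whole slice close to the class of [x0], then
    [- phi] times that class is a norm-one operator [T] of rank one for which
    [p + T p] has norm at most 15/8 on the unit ball: inside the slices
    |phi| > 7/8 because [p] is close to the class of [x0] up to sign, outside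
    because [T p] has norm at most 7/8.  The constants 9/8, 7/8 and 7/4 are
    there to absorb the approximations made in concrete spaces. *)
Lemma not_daugavet_quot (phi : {scalar X}) (x0 : X) :
  (forall x, `|phi x| <= `|x|) -> (forall z, subspace_set Z z -> phi z = 0) ->
  `|x0| <= 1 -> phi x0 = 1 ->
  (forall x, `|x| < 9/8 -> 7/8 < phi x ->
     exists2 z, subspace_set Z z & `|x - x0 - z| <= 7/4) ->
  ~ daugavet Q.
Proof.
move=> phi1 phiZ x01 phix0 slice daug.
pose phiq (p : Q) := phi (repr p).
have phiqE x : phiq (\pi_Q x) = phi x.
  apply/eqP; rewrite -subr_eq0 -linearB; apply/eqP/phiZ.
  by apply/quot_eqP; rewrite reprK.
have phiqL : linear_for *%R phiq.
  move=> a p q; rewrite -[p]reprK -[q]reprK -quot_piL !phiqE.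
  by rewrite linearD scalarZ.
have phiq1 p : `|phiq p| <= `|p|.
  apply/ler_addgt0Pr => e /(quot_norm_lift p)[x <- xp].
  by rewrite phiqE (le_trans (phi1 x))// ltW.
pose y0 := \pi_Q x0.
have y01 : `|y0| <= 1 by exact: le_trans (quot_norm_pi x0) _.
have phiy0 : phiq y0 = 1 by rewrite phiqE.
have TL : linear (fun p => - phiq p *: y0).
  move=> a p q; rewrite phiqL opprD scalerDl; congr (_ + _).
  by rewrite -mulrN scalerA.
have [T TE] := linear_bundle TL.
have Tle p : `|T p| <= `|p|.
  by rewrite TE normrZ normrN -[leRHS]mulr1 ler_pM.
have Tcont : continuous T.
  apply: bounded_linear_continuous; apply/bounded_funP => r.
  by exists r => p pr; exact: le_trans (Tle p) _.
have Trank : rank_one T.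
  exists y0.
    apply/eqP => y00; have := phiq1 y0; rewrite phiy0 y00 normr0 normr1.
    by rewrite ler10.
  apply/seteqP; split=> [_ [p _ <-]|_ [a _ <-]].
    by exists (- phiq p) => //; rewrite TE.
  exists (- a *: y0) => //.
  by rewrite linearZ/= TE phiy0 scaleN1r scalerN scaleNr opprK.
have opT : 1 <= opnorm T.
  apply: ub_le_sup; last first.
    exists y0 => //; rewrite TE phiy0 scaleN1r normrN; apply/eqP.
    by rewrite eq_le y01 -[leLHS]normr1 -[X in `|X|]phiy0 phiq1.
  by exists 1 => _ [p /= p1 <-]; exact: le_trans (Tle p) _.
have sliceT (p : Q) : `|p| <= 1 -> 7/8 < phiq p -> `|p + T p| <= 15/8.
  move=> p1 phip; have [//|x xp xlt] := @quot_norm_lift p (1/8).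
  have [| |z Zz xz] := slice x; [lra|by rewrite -phiqE xp|].
  (* y0 is not phi(p) y0; the difference costs at most 1/8 *)
  have -> : p + T p = \pi_Q (x - x0 - z) + (1 - phiq p) *: y0.
    by rewrite !quot_piB (quot_pi0 Zz) subr0 xp TE scalerBl scale1r addrA subrK
      scaleNr.
  apply: le_trans (ler_normD _ _) _.
  have p78 : `|1 - phiq p| <= 1/8.
    by have := phiq1 p; rewrite !ler_norml => /andP[_ ?]; apply/andP; split; lra.
  rewrite [leRHS](_ : _ = 7/4 + 1/8 * 1); last by lra.
  rewrite lerD ?normrZ ?ler_pM//.
  exact: le_trans (quot_norm_pi _) _.
have phiqN p : phiq (- p) = - phiq p.
  by have [F FE] := linear_bundle phiqL; rewrite -FE linearN.
have idT (p : Q) : `|p| <= 1 -> `|p + T p| <= 15/8.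
  move=> p1; have [h|h] := ltP (7/8) (phiq p); first exact: sliceT.
  have [h'|h'] := ltP (phiq p) (-(7/8)).
    rewrite -normrN opprD -linearN; apply: sliceT; first by rewrite normrN.
    by rewrite phiqN; lra.
  apply: le_trans (ler_normD _ _) _; rewrite TE normrZ normrN.
  have := ler_pM (normr_ge0 _) (normr_ge0 _) (lexx `|phiq p|) y01.
  have : `|phiq p| <= 7/8 by rewrite ler_norml; lra.
  lra.
have := daug T Tcont Trank; suff : opnorm (fun x => x + T x) <= 15/8 by lra.
apply: ge_sup; first by exists `|0 + T 0|, 0 => //=; rewrite normr0.
by move=> _ [p p1 <-]; exact: idT.
Qed.
End quotient.

(** The closed span of [u] is itself the subspace whose quotient fails the
    Daugavet property. *)
Theorem nonpoor_l1_copy (R : realType) (X : normedModType R) (u : nat -> X)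
    (C d : R) (phi : {scalar X}) (x0 : X) :
  absolutely_summable X ->
  (forall n, `|u n| <= C) -> 0 < d -> sign_separated d u ->
  (forall x, `|phi x| <= `|x|) -> (forall n, phi (u n) = 0) ->
  `|x0| <= 1 -> phi x0 = 1 ->
  (forall x, `|x| < 9/8 -> 7/8 < phi x ->
     exists n, `|x - x0 - u n| <= 7/4) ->
  exists Z : closedSubspace X, isomorphic_to_subspace (l1 R) Z /\ ~ poor Z.
Proof.
move=> Xsum uC d0 lower phi1 phiu x01 phix0 slice.
exists (l1_span Xsum uC d0 lower); split; first exact: l1_span_isomorphic.
move=> /(_ (l1_span Xsum uC d0 lower) (@subset_refl _ _)).
apply: (@not_daugavet_quot _ _ _ phi x0) => //.
- by move=> _ [a _ <-]; exact: (l1_comb_vanish Xsum uC).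
- move=> x x98 phix; have [n xn] := slice x x98 phix.
  by exists (u n) => //; exact: l1_comb_unit.
Qed.

(** * The space C(K) *)

Section continuous_functions.
Context (R : realType) (K : topologicalType) (cK : compact [set: K]).
Local Notation C := (CK R cK).

Lemma CK_val_continuous (f : C) : continuous (CK_val f).
Proof. exact: (@cts_fun _ _ (f : continuousType K R)). Qed.

Lemma CK_of_continuous (f : K -> R) : continuous f -> exists F : C, CK_val F = f.
Proof.
move=> cf; have fP : f \in @CK_pred R K by rewrite inE.
by exists (CK_Sub cK fP).
Qed.

Lemma CK_norm_ge (f : C) s : `|CK_val f s| <= `|f|.
Proof.
have cf : continuous (fun s => `|CK_val f s|).
  by move=> x; apply: cvg_norm; exact: CK_val_continuous.
apply: ub_le_sup; last by exists s.
have /compact_bounded[M [_ MB]] : compact (range (fun s => `|CK_val f s|)).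
  by apply: continuous_compact => //; exact: continuous_subspaceT.
exists (M + 1) => _ [x _ <-]; rewrite -[leLHS]normr_id.
by apply: MB; [rewrite ltrDl|exists x].
Qed.

Lemma CK_norm_le (f : C) M : 0 <= M ->
  (forall s, `|CK_val f s| <= M) -> `|f| <= M.
Proof.
move=> M0 fM; rewrite /Num.norm/= /CK_norm.
have [->|/set0P K0] := eqVneq (range (fun s => `|CK_val f s|)) set0.
  by rewrite sup0.
by apply: ge_sup => // _ [s _ <-].
Qed.

Lemma CK_valB (f g : C) s : CK_val (f - g) s = CK_val f s - CK_val g s.
Proof. by []. Qed.

Lemma CK_eval s : exists psi : {scalar C}, psi = (fun f => CK_val f s) :> (C -> R).
Proof. by apply: linear_bundle => a f g. Qed.

Lemma CK_val_series (v : nat -> C) N s :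
  CK_val (series v N) s = series (fun n => CK_val (v n) s) N.
Proof.
by have [psi E] := CK_eval s; rewrite -[LHS](congr1 (@^~ _) E) linear_sum/= E.
Qed.

(** The Weierstrass test: the pointwise sum [g] is approximated uniformly by the
    partial sums, the error being at most the tail of the series of norms. *)
Lemma CK_absolutely_summable : absolutely_summable C.
Proof.
move=> v cv; set L := limn [series `|v n|]_n.
have tail N M s : (N <= M)%N ->
    `|CK_val (series v M - series v N) s| <= L - [series `|v n|]_n N.
  move=> NM; apply: le_trans (CK_norm_ge _ _) _.
  rewrite sub_series NM (le_trans (ler_norm_sum _ _ _))// lerBrDl.
  rewrite -[X in X + _ <= _]/(series _ _) seriesEnat/= -big_cat_nat//=.
  rewrite -[leLHS]/([series `|v n|]_n M).
  apply: nondecreasing_cvgn_le => //.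
  by apply: nondecreasing_series => n _ _; exact: normr_ge0.
have vs s : cvgn (series (fun n => CK_val (v n) s)).
  apply: (@normed_cvg R R^o); apply: series_le_cvg cv => n /=; rewrite ?normr_ge0//.
  exact: CK_norm_ge.
pose g s := limn (series (fun n => CK_val (v n) s)).
have gtail N s : `|g s - CK_val (series v N) s| <= L - [series `|v n|]_n N.
  have cN : `|CK_val (series v M) s - CK_val (series v N) s| @[M --> \oo] -->
      `|g s - CK_val (series v N) s|.
    apply: cvg_norm; apply: cvgB; last exact: cvg_cst.
    by under eq_fun do rewrite CK_val_series; exact: vs.
  rewrite -(cvg_lim _ cN)//.
  apply: limr_le; first by apply/cvg_ex; eexists; exact: cN.
  by near=> M; rewrite -CK_valB; apply: tail; near: M; exact: nbhs_infty_ge.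
have small e : 0 < e ->
    exists N, forall M, (N <= M)%N -> L - [series `|v n|]_n M < e.
  move=> e0; have /cvgrPdist_lt/(_ _ e0)[N _ h] := cv.
  by exists N => // M /h/=; apply: le_lt_trans; exact: ler_norm.
have cg : continuous g.
  move=> s; apply/cvgrPdist_lt => e e0.
  have [N /(_ N (leqnn N)) Ne] := small _ (divr_gt0 e0 (ltr0n R 4)).
  near=> t; rewrite -(subrKA (CK_val (series v N) s)).
  rewrite -[X in _ + X](subrKA (CK_val (series v N) t)).
  have h1 := gtail N s; have h2 := gtail N t; rewrite distrC in h2.
  have h3 : `|CK_val (series v N) s - CK_val (series v N) t| < e / 2.
    by near: t; apply: cvgr_dist_lt; [exact: CK_val_continuous|rewrite divr_gt0].
  have := ler_normD (g s - CK_val (series v N) s)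
    (CK_val (series v N) s - CK_val (series v N) t + (CK_val (series v N) t - g t)).
  have := ler_normD (CK_val (series v N) s - CK_val (series v N) t)
    (CK_val (series v N) t - g t).
  lra.
have [G GE] := CK_of_continuous cg.
apply/cvg_ex; exists G; apply/cvgrPdist_le => e e0.
have [N Ne] := small _ e0; near=> M.
apply: CK_norm_le; first exact: ltW.
move=> s; rewrite CK_valB GE (le_trans (gtail _ _))// ltW// Ne//.
by near: M; exact: nbhs_infty_ge.
Unshelve. all: by end_near. Qed.

End continuous_functions.

(** * Separability of C(K) for compact metric K *)

Section compact_metric.
Context (R : realType) (K : pseudoMetricType R) (cK : compact [set: K]).

(** The near-covering form of compactness is applied to the finite sequences of
    points, filtered by inclusion. *)
Lemma compact_finite_net (e : R) : 0 < e ->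
  exists s : seq K, forall x, exists2 p, p \in s & ball p e x.
Proof.
move=> e0.
pose F : set_system (seq K) :=
    [set A : set (seq K) |
      exists s : seq K, forall r : seq K, {subset s <= r} -> A r].
have FF : Filter F.
  split; first by exists [::].
    move=> A B [s sA] [r rB]; exists (s ++ r) => q sq; split.
      by apply: sA => x xs; apply: sq; rewrite mem_cat xs.
    by apply: rB => x xr; apply: sq; rewrite mem_cat xr orbT.
  by move=> A B AB [s sA]; exists s => r /sA/AB.
have [|s sP] := (compact_near_coveringP _).1 cK _ F
    (fun s x => exists2 p, p \in s & ball p e x) FF.
  move=> x _; exists (ball x e, [set s : seq K | x \in s]) => /=.
    by split; [exact: nbhsx_ballx|exists [:: x] => r; apply; exact: mem_head].
  by move=> [y s] /= [xy xs]; exists x.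
by exists s => x; exact: (sP s (fun _ => id)).
Qed.

Lemma compact_uniform_continuity (f : K -> R) (e : R) : continuous f -> 0 < e ->
  exists n, forall x y, ball x n.+1%:R^-1 y -> `|f x - f y| < e.
Proof.
move=> cf e0.
have [|d /= d0 dP] := (compact_near_coveringP _).1 cK _ (0 : R)^'+
    (fun d x => forall y, ball x d y -> `|f x - f y| < e) _.
  move=> x _; have /cvgrPdist_lt/(_ _ (divr_gt0 e0 (ltr0n R 2))) := cf x.
  move=> /nbhs_ballP[r /= r0 xr].
  exists (ball x (r / 2), [set d | d < r / 2]) => /=.
    by split; [apply: nbhsx_ballx|apply: nbhs_right_lt]; rewrite divr_gt0.
  move=> [z d] /= [xz dr] y zy.
  have xz' : ball x r z 
    by apply: le_ball xz; rewrite ler_pdivrMr// ler_peMr ?ler1n// ltW.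
  have xy : ball x r y.
    by rewrite [r]splitr; apply: ball_triangle xz _; apply: le_ball zy; exact: ltW.
  rewrite -(subrKA (f x)) (le_lt_trans (ler_normD _ _))// [ltRHS]splitr ltrD//.
    by rewrite distrC xr.
  exact: xr.
have [n _ /(_ n (leqnn n)) /= nd] := near_infty_natSinv_lt (PosNum d0).
exists n => x y xy; apply: (dP (n.+1%:R^-1)) => //=.
by rewrite sub0r normrN gtr0_norm ?invr_gt0.
Qed.

(** Two functions with the same [data], that is, with the same radius of uniform
    continuity and the same discretized values on a fixed finite net of that
    mesh, are within [e] of each other.  The data range over a countable type,
    so one function for each value of the data suffices. *)
Lemma CK_countable_net (e : R) : 0 < e ->
  exists x : nat -> CK R cK, forall f, exists n, `|f - x n| <= e.
Proof.
move=> e0; have e4 : 0 < e / 4 by rewrite divr_gt0.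
have /choice[P PP] : forall n, exists s : seq K, forall x,
    exists2 p, p \in s & ball p n.+1%:R^-1 x.
  by move=> n; apply: compact_finite_net; rewrite invr_gt0.
have /choice[m mP] : forall f : CK R cK, exists n, forall x y,
    ball x n.+1%:R^-1 y -> `|CK_val f x - CK_val f y| < e / 4.
  by move=> f; apply: compact_uniform_continuity e4; exact: CK_val_continuous.
pose data f : nat * seq int :=
  (m f, [seq Num.floor (CK_val f p / (e / 4)) | p <- P (m f)]).
have close f g : data f = data g -> `|f - g| <= e.
  move=> fg; apply: CK_norm_le; first exact: ltW.
  move=> s; rewrite CK_valB.
  have mfg : m g = m f by have := congr1 fst fg.
  have [p pP ps] := PP (m f) s.
  have : Num.floor (CK_val f p / (e / 4)) = Num.floor (CK_val g p / (e / 4)).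
    have := congr1 snd fg; rewrite /data/= mfg => /eq_in_map; exact.
  set a := CK_val f p / (e / 4); set b := CK_val g p / (e / 4) => ab.
  have /andP[a1 a2] := floor_itv a.
  have /andP[b1 b2] := floor_itv b.
  have fE : CK_val f p = a * (e / 4) by rewrite divfK// gt_eqF.
  have gE : CK_val g p = b * (e / 4) by rewrite divfK// gt_eqF.
  have abe : `|a * (e / 4) - b * (e / 4)| <= e / 4.
    rewrite -mulrBl normrM (gtr0_norm e4) ler_piMl ?(ltW e4)//.
    rewrite ab in a1 a2; rewrite intrD in a2 b2; rewrite ler_norml; lra.
  have h1 := mP f _ _ ps; have h2 : `|CK_val g p - CK_val g s| < e / 4.
    by apply: mP; rewrite mfg.
  move: h1 h2 abe; rewrite fE gE ltr_norml ltr_norml !ler_norml; lra.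
pose x n : CK R cK := if pselect (exists f, pickle (data f) = n) is left h
  then projT1 (cid h) else 0.
exists x => f; exists (pickle (data f)); apply: close.
rewrite /x; case: pselect => [h|]; last by case; exists f.
by case: cid => g /= gf; apply: (pcan_inj pickleK).
Qed.

End compact_metric.

(** * Functions with all sign patterns on an open set *)

Section independent_signs.
Context (R : realType) (K : topologicalType).
Hypotheses (hK : hausdorff_space K) (nK : normal_space K).
Hypothesis pK : perfect_set [set: K].

Lemma closed_seq (s : seq K) : closed [set` s].
Proof.
exact: (accessible_finite_set_closed.1 (hausdorff_accessible hK)).
Qed.

Lemma perfect_open_avoid (V : set K) (s : seq K) : open V -> V !=set0 ->
  exists2 x, V x & x \notin s.
Proof.
elim: s V => [|y s IH] V oV V0; first by case: V0 => x Vx; exists x.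
have oVy : open (V `&` ~` [set y]).
  apply: openI => //; apply: closed_openC.
  exact: accessible_closed_set1 (hausdorff_accessible hK) _.
have [|x [Vx xy] xs] := IH _ oVy.
  have [a [b [Va Vb ab]]] := (perfectTP_ex.1 pK) V oV V0.
  have [ay|ay] := eqVneq a y; last by exists a; split=> //; exact/eqP.
  by exists b; split=> // /= bY; move: ab; rewrite ay bY eqxx.
by exists x => //; rewrite inE negb_or xs andbT; exact/eqP.
Qed.

(** Choose in each [V i] two points, one for [A] and one for [B], keeping [A]
    and [B] disjoint: a nonempty open set of a perfect space is infinite.  Then
    separate the finite sets [A] and [B] by Urysohn's lemma. *)
Lemma sign_on_opens (J : finType) (V : J -> set K) :
  (forall i, open (V i)) -> (forall i, V i !=set0) ->
  exists f : K -> R, [/\ continuous f, forall x, `|f x| <= 1 &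
    forall i (b : bool), exists2 x, V i x & f x = (-1) ^+ b].
Proof.
move=> oV V0.
have [A [B [AB AV BV]]] : exists A B : seq K, [/\ forall x, x \in A -> x \notin B,
    forall i, exists2 x, V i x & x \in A & forall i, exists2 x, V i x & x \in B].
  suff [A [B [AB ABV]]] : exists A B : seq K, (forall x, x \in A -> x \notin B) /\
      forall i, i \in enum J ->
        (exists2 x, V i x & x \in A) /\ (exists2 x, V i x & x \in B).
    by exists A, B; split => // i; have [] := ABV i (mem_enum _ _).
  elim: (enum J) => [|i r [A [B [AB IH]]]]; first by exists [::], [::].
  have [x Vx xAB] := perfect_open_avoid (A ++ B) (oV i) (V0 i).
  have [y Vy yxAB] := perfect_open_avoid (x :: A ++ B) (oV i) (V0 i).
  move: xAB yxAB; rewrite inE !mem_cat !negb_or => /andP[xA xB] /and3P[yx yA yB].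
  exists (x :: A), (y :: B); split.
    move=> z; rewrite !inE negb_or => /orP[/eqP->|zA]; first by rewrite eq_sym yx.
    by rewrite AB// andbT; apply: contraNneq yA => <-.
  move=> j; rewrite inE => /orP[/eqP->|/IH[[a Va aA] [b Vb bB]]].
    by split; [exists x|exists y] => //; exact: mem_head.
  by split; [exists a|exists b] => //; rewrite inE (aA, bB) orbT.
have sep : uniform_separator [set` A] [set` B].
  apply: ((@normal_separatorP R K).1 nK); [exact: closed_seq|exact: closed_seq|].
  by apply/seteqP; split=> // x [/= /AB/negP].
have [f [cf f01 fA fB]] := (@uniform_separatorP _ R _ _).1 sep.
exists (fun x => 1 - 2 * f x); split.
- move=> x; apply: cvgB; first exact: cvg_cst.
  by apply: cvgM; [exact: cvg_cst|exact: cf].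
- move=> x; have /= := f01 (f x) (ex_intro2 _ _ x I erefl).
  by rewrite in_itv/= => /andP[? ?]; rewrite ler_norml; apply/andP; split; lra.
- move=> i [].
    have [x Vx xB] := BV i; exists x => //.
    by rewrite (fB (f x)) ?expr1; [lra|exists x].
  have [x Vx xA] := AV i; exists x => //.
  by rewrite (fA (f x)) ?expr0; [lra|exists x].
Qed.

(** The bound 1/2 is strict so that the points with a given sign pattern form
    open sets, to which [sign_on_opens] applies again. *)
Let spread (W : set K) (fs : seq (K -> R)) : Prop :=
  (forall i, (i < size fs)%N -> continuous (nth (cst 0) fs i)) /\
  forall th : nat -> bool, exists2 s, W s &
    forall i, (i < size fs)%N -> 1/2 < (-1) ^+ th i * nth (cst 0) fs i s.

Let spread_rcons (W : set K) fs : open W -> spread W fs ->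
  exists f, [/\ continuous f, forall x, `|f x| <= 1 & spread W (rcons fs f)].
Proof.
move=> oW [cfs sfs].
pose V (g : {ffun 'I_(size fs) -> bool}) := W `&`
  [set s | forall i : 'I_(size fs), 1/2 < (-1) ^+ g i * nth (cst 0) fs i s].
have oV g : open (V g).
  rewrite openE => s [Ws Vs]; apply: filterI; first exact: open_nbhs_nbhs.
  apply: filter_forall => i; move: (Vs i); apply: cvgr_gt.
  by apply: cvgM; [exact: cvg_cst|exact: cfs].
have V0 g : V g !=set0.
  have [s Ws sP] := sfs (fun i => if insub i is Some j then g j else false).
  exists s; split => // i; have := sP i (ltn_ord i).
  by rewrite valK.
have [f [cf f1 fV]] := sign_on_opens oV V0.
have nthr i : nth (cst 0) (rcons fs f) i = if (i < size fs)%N then nth (cst 0) fs i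
    else if i == size fs then f else cst 0 by rewrite nth_rcons.
exists f; split => //; split.
  move=> i; rewrite size_rcons ltnS leq_eqVlt nthr => /orP[/eqP->|ifs].
    by rewrite ltnn eqxx.
  by rewrite ifs; exact: cfs.
move=> th; have [s [Ws Vs] fs1] := fV [ffun i => th (val i)] (th (size fs)).
exists s => // i; rewrite size_rcons ltnS leq_eqVlt nthr => /orP[/eqP->|ifs].
  by rewrite ltnn eqxx fs1 -expr2 sqrr_sign; lra.
by rewrite ifs; have := Vs (Ordinal ifs); rewrite ffunE.
Qed.

(** A substitute for the Rademacher functions: such a sequence spans l_1 in the
    supremum norm over [W]. *)
Lemma independent_signs (W : set K) : open W -> W !=set0 ->
  exists f : nat -> K -> R, [/\ forall n, continuous (f n),
    forall n x, `|f n x| <= 1 &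
    forall (th : nat -> bool) N, exists2 s, W s &
      forall i, (i < N)%N -> 1/2 < (-1) ^+ th i * f i s].
Proof.
move=> oW [w Ww].
have /choice[F FP] : forall fs, exists f, spread W fs ->
    [/\ continuous f, forall x, `|f x| <= 1 & spread W (rcons fs f)].
  move=> fs; have [h|h] := pselect (spread W fs); last by exists (cst 0).
  by have [f fP] := spread_rcons oW h; exists f.
pose S n := iter n (fun fs => rcons fs (F fs)) [::].
have SP n : spread W (S n).
  by elim: n => [|n /FP[]//]; split => // th; exists w.
have SE n : S n = mkseq (F \o S) n by elim: n => //= n IH; rewrite mkseqS -IH.
exists (F \o S); split => [n|n x|th N].
- by have [] := FP _ (SP n).
- by have [_ /(_ x)] := FP _ (SP n).
- have [_ /(_ th)[s Ws sP]] := SP N; exists s => // i iN.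
  by have := sP i; rewrite SE size_mkseq nth_mkseq//; exact.
Qed.

End independent_signs.

(** * A non-poor copy of l_1 in C(K) *)

Section nonpoor_CK.
Context (R : realType) (K : topologicalType) (cK : compact [set: K]).
Hypotheses (hK : hausdorff_space K) (pK : perfect_set [set: K]).

(** With f = 0 at [t] and f = 1 at [p], [x0] is supported in f <= 1/3, [h] in
    f >= 1/3, and [W] is the set f > 2/3. *)
Lemma disjoint_bumps (t p : K) : t != p ->
  exists x0 h : K -> R, exists W : set K,
    [/\ continuous x0, continuous h, open W & W !=set0] /\
    [/\ forall s, 0 <= x0 s <= 1, forall s, 0 <= h s <= 1, x0 t = 1,
        forall s, x0 s = 0 \/ h s = 0 & forall s, W s -> h s = 1].
Proof.
move=> tp; have cl1 := accessible_closed_set1 (hausdorff_accessible hK).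
have sep : uniform_separator [set t] [set p].
  apply: ((@normal_separatorP R K).1 (compact_normal hK cK)) => //.
  by apply/seteqP; split=> // x /= [-> /eqP]; rewrite (negPf tp).
have [f [cf f01 ft fp]] := (@uniform_separatorP _ R _ _).1 sep.
have {}ft : f t = 0 by apply: ft; exists t.
have {}fp : f p = 1 by apply: fp; exists p.
have {}f01 s : 0 <= f s <= 1.
  by have /= := f01 (f s) (ex_intro2 _ _ s I erefl); rewrite in_itv.
have c3f : continuous (fun s => 3 * f s).
  by move=> s; apply: cvgM; [exact: cvg_cst|exact: cf].
have cmax0 (g : K -> R) : continuous g -> continuous (fun s => Num.max 0 (g s)).
  by move=> cg s; apply: (@continuous_max R K (cst 0)); [exact: cvg_cst|exact: cg].
exists (fun s => Num.max 0 (1 - 3 * f s)).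
exists (fun s => Num.min 1 (Num.max 0 (3 * f s - 1))).
exists (f @^-1` [set y | 2/3 < y]); split; split.
- exact: cmax0 (fun s => 1 - 3 * f s) (fun s => cvgB (cvg_cst _) (c3f s)).
- move=> s; apply: (@continuous_min R K (cst 1) (fun s => Num.max 0 (3 * f s - 1))).
    exact: cvg_cst.
  exact: cmax0 (fun s => 3 * f s - 1) (fun s => cvgB (c3f s) (cvg_cst _)) s.
- by apply: open_comp => [s _|]; [exact: cf|exact: open_gt].
- by exists p; rewrite /= fp; lra.
- move=> s; have /andP[? ?] := f01 s; rewrite le_max lexx ge_max ler01/=; lra.
- by move=> s; rewrite le_min ler01 le_max lexx ge_min lexx.
- by rewrite ft mulr0 subr0; apply/max_idPr.
- move=> s; have [h|h] := leP (f s) (1/3).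
    right; rewrite (max_idPl _) ?(min_idPr _)//; lra.
  by left; apply/max_idPl; lra.
- by move=> s /= fs; apply/min_idPl; rewrite le_max; apply/orP; right; lra.
Qed.

(** On [W] the function [u n] equals [f n / 4], which gives the l_1-estimate.
    Where [h] does not vanish, [x0] does, so that [x - x0 - u n] is there at
    most about norm(x) + 1/4; elsewhere [u n] is within a small error of
    [x - x0]. *)
Theorem CK_nonpoor_l1_copy (x : nat -> CK R cK) :
  [set: K] !=set0 -> (forall f, exists n, `|f - x n| <= 1/16) ->
  exists Z : closedSubspace (CK R cK), isomorphic_to_subspace (l1 R) Z /\ ~ poor Z.
Proof.
move=> K0 xnet.
have [t [p [_ _ tp]]] := (perfectTP_ex.1 pK) _ openT K0.
have [x0 [h [W [[cx0 ch oW W0] [x001 h01 x0t x0h hW]]]]] := disjoint_bumps tp.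
have [f [cf f1 fW]] := @independent_signs R K hK (compact_normal hK cK) pK W oW W0.
(* the u n must be bounded, and only x of norm below 9/8 is to be approximated *)
pose y n : CK R cK := if `|x n| <= 2 then x n else 0.
have y2 n : `|y n| <= 2 by rewrite /y; case: ifP => // _; rewrite normr0.
have ht : h t = 0 by case: (x0h t) => // x0t0; move: x0t; rewrite x0t0; lra.
have /choice[u uE] : forall n, exists u : CK R cK, CK_val u = fun s =>
    CK_val (y n) s - CK_val (y n) t * x0 s - h s * (CK_val (y n) s - f n s / 4).
  move=> n; apply: CK_of_continuous => s; apply: cvgB.
    apply: cvgB; first exact: CK_val_continuous.
    by apply: cvgM; [exact: cvg_cst|exact: cx0].
  apply: cvgM; first exact: ch.
  apply: cvgB; first exact: CK_val_continuous.
  by apply: cvgM; [exact: cf|exact: cvg_cst].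
have [X0 X0E] := CK_of_continuous cK cx0.
have [phi phiE] := CK_eval R cK t.
apply: (@nonpoor_l1_copy R (CK R cK) u 7 (1/8) phi X0).
- exact: CK_absolutely_summable.
- move=> n; apply: CK_norm_le => // s; rewrite uE.
  have := le_trans (CK_norm_ge (y n) s) (y2 n).
  have := le_trans (CK_norm_ge (y n) t) (y2 n).
  have /andP[h0 h1] := h01 s; have /andP[x00 x01] := x001 s.
  have := f1 n s; set a := CK_val _ s; set b := CK_val _ t => fn bn an.
  have bx : `|b * x0 s| <= 2.
    by rewrite normrM (ger0_norm x00) -[2]mulr1 ler_pM.
  have hn : `|h s * (a - f n s / 4)| <= 3.
    rewrite normrM (ger0_norm h0) -[3]mul1r ler_pM//.
    by move: an fn; rewrite !ler_norml; lra.
  by move: an bx hn; rewrite !ler_norml; lra.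
- lra.
- move=> th N; have [s Ws fs] := fW th N.
  have [psi psiE] := CK_eval R cK s.
  exists psi; split => [g|i iN]; rewrite psiE; first exact: CK_norm_ge.
  have hs := hW s Ws; rewrite uE hs.
  have -> : x0 s = 0 by case: (x0h s) => //; rewrite hs; lra.
  have := fs i iN; set e := (-1) ^+ _ => ef.
  have -> : CK_val (y i) s - CK_val (y i) t * 0 - 1 * (CK_val (y i) s - f i s / 4)
    = f i s / 4 by lra.
  lra.
- by move=> g; rewrite phiE; exact: CK_norm_ge.
- by move=> n; rewrite phiE uE x0t ht; lra.
- apply: CK_norm_le => // s; rewrite X0E.
  by have /andP[? ?] := x001 s; rewrite ger0_norm.
- by rewrite phiE X0E x0t.
move=> g g98; rewrite phiE => gt; have [n gn] := xnet g; exists n.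
have yn : y n = x n.
  rewrite /y ifT//; have := ler_normD (x n - g) g; rewrite subrK distrC; lra.
apply: CK_norm_le; first lra.
move=> s; rewrite !CK_valB uE X0E yn.
have gs := CK_norm_ge g s; have gt' := CK_norm_ge g t.
have := le_trans (CK_norm_ge (g - x n) s) gn.
have := le_trans (CK_norm_ge (g - x n) t) gn.
rewrite !CK_valB.
have /andP[h0 h1] := h01 s; have /andP[x00 x01] := x001 s; have := f1 n s.
move: gs gt' gt; set a := CK_val (x n) s; set b := CK_val (x n) t.
set c := CK_val g s; set d := CK_val g t => gs gt' gt fn db ca.
case: (x0h s) => [->|->].
  have hn : `|h s * (a - f n s / 4)| <= 23/16.
    rewrite normrM (ger0_norm h0) -[leRHS]mul1r ler_pM//.
    by move: fn gs ca; rewrite !ler_norml; lra.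
  rewrite mulr0; move: hn ca; rewrite !ler_norml; lra.
have bn : `|(b - 1) * x0 s| <= 3/16.
  rewrite normrM (ger0_norm x00) -[leRHS]mulr1 ler_pM//.
  by move: db gt'; rewrite !ler_norml; lra.
move: bn ca; rewrite mulrBl mul1r mul0r !ler_norml; lra.
Qed.

End nonpoor_CK.

Theorem CK_metric_nonpoor_l1_copy (R : realType) (K : metricType R)
    (cK : compact [set: K]) : [set: K] !=set0 -> perfect_set [set: K] ->
  exists Z : closedSubspace (CK R cK), isomorphic_to_subspace (l1 R) Z /\ ~ poor Z.
Proof.
move=> K0 pK; have [|x xnet] := @CK_countable_net R K cK (1/16); first lra.
by apply: CK_nonpoor_l1_copy xnet; first exact: metric_hausdorff.
Qed.

(** * The space L_1 *)

Section L1_space.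
Context d (T : measurableType d) (R : realType).
Variable mu : {measure set T -> \bar R}.

Lemma L1_integrable (p : L1 mu) : mu.-integrable setT (EFin \o L1_fun p).
Proof. by apply/Lfun1_integrable; exact: LfunP. Qed.

Lemma L1_of_integrable (f : T -> R) : mu.-integrable setT (EFin \o f) ->
  exists p : L1 mu, (L1_fun p : T -> R) = f %[ae mu].
Proof.
move=> /Lfun1_integrable fL.
by exists (L1_class (Lfun_Sub (lexx 1%E) fL)); exact: L1_classK.
Qed.

Lemma L1_normE (p : L1 mu) : (`|p|%:E = \int[mu]_x `|L1_fun p x|%:E)%E.
Proof. exact: etrans (finite_norm_fine (L1_fun p)) (Lnorm1 _ _). Qed.

Lemma L1_funZD (a : R) (p q : L1 mu) :
  (L1_fun (a *: p + q) : T -> R) = (fun x => a * L1_fun p x + L1_fun q x) %[ae mu].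
Proof.
have -> : a *: p + q = L1_class (a *: L1_fun p + L1_fun q); last exact: L1_classK.
by rewrite -{1}[p]L1_funK -{1}[q]L1_funK [LHS]/GRing.add/=
  [X in L1_add X]L1_scaleE L1_addE.
Qed.

Lemma L1_fun_measurable (p : L1 mu) : measurable_fun setT (L1_fun p : T -> R).
Proof. exact: (@measurable_funPT _ _ _ _ (L1_fun p)). Qed.

Section pairing.
Variable g : T -> R.
Hypotheses (mg : measurable_fun setT g) (g1 : forall x, `|g x| <= 1).

Lemma integrable_mul_bounded (f : T -> R) :
  mu.-integrable setT (EFin \o f) ->
  mu.-integrable setT (EFin \o (fun x => f x * g x)).
Proof.
move=> fi; have /measurable_EFinP mf := measurable_int mu fi.
apply: le_integrable fi => //.
  by apply/measurable_EFinP; exact: measurable_funM.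
by move=> x _ /=; rewrite lee_fin normrM ler_piMr.
Qed.

Lemma Rintegral_mul_ae_eq (f h : T -> R) :
  measurable_fun setT f -> measurable_fun setT h -> f = h %[ae mu] ->
  (\int[mu]_x (f x * g x))%R = (\int[mu]_x (h x * g x))%R.
Proof.
move=> mf mh fh; congr fine; apply: ae_eq_integral => //.
- by apply/measurable_EFinP; exact: measurable_funM.
- by apply/measurable_EFinP; exact: measurable_funM.
- by apply: filterS fh => x /= /[apply] ->.
Qed.

Lemma L1_pairing : exists psi : {scalar L1 mu},
  (forall p, psi p = (\int[mu]_x (L1_fun p x * g x))%R) /\
  (forall p, `|psi p| <= `|p|).
Proof.
pose f (p : L1 mu) := (\int[mu]_x (L1_fun p x * g x))%R.
have fL : linear_for *%R f.
  move=> a p q; rewrite /f (Rintegral_mul_ae_eq _ _ (L1_funZD a p q)); last 2 first.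
  - exact: L1_fun_measurable.
  - by apply: measurable_funD; [apply: measurable_funM => //|]; exact: L1_fun_measurable.
  under eq_Rintegral do rewrite mulrDl -mulrA.
  have ip := integrable_mul_bounded (L1_integrable p).
  have iq := integrable_mul_bounded (L1_integrable q).
  rewrite RintegralD ?RintegralZl//.
  by apply: eq_integrable (integrableZl measurableT a ip) => // x _;
    rewrite /= EFinM.
have [psi psiE] := linear_bundle fL; exists psi; rewrite psiE; split=> // p.
apply: le_trans (le_normr_Rintegral _ _) _ => //.
  exact: integrable_mul_bounded (L1_integrable p).
rewrite -lee_fin L1_normE fineK.
  apply: ge0_le_integral => //=.
  - apply/measurable_EFinP; apply: measurableT_comp => //.
    by apply: measurable_funM => //; exact: L1_fun_measurable.
  - by apply/measurable_EFinP; apply: measurableT_comp => //; exact: L1_fun_measurable.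
  - by move=> x _; rewrite lee_fin normrM ler_piMr.
apply: integrable_fin_num => //.
have /integrable_norm := integrable_mul_bounded (L1_integrable p).
exact.
Qed.

End pairing.

Lemma L1_pairingD (g h : T -> R) (p : L1 mu) :
  measurable_fun setT g -> (forall x, `|g x| <= 1) ->
  measurable_fun setT h -> (forall x, `|h x| <= 1) ->
  (\int[mu]_x (L1_fun p x * (g x + h x)) =
   \int[mu]_x (L1_fun p x * g x) + \int[mu]_x (L1_fun p x * h x))%R.
Proof.
move=> mg g1 mh h1; under eq_Rintegral do rewrite mulrDr.
by rewrite RintegralD//; apply: integrable_mul_bounded => //; exact: L1_integrable.
Qed.

(** [p] is the normalized indicator of [A], known here through the functionals
    that are tested against it. *)
Lemma L1_bump (A : set T) : measurable A -> (0 < mu A < +oo)%E ->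
  exists p : L1 mu, `|p| <= 1 /\
    forall (g : T -> R) c, measurable_fun setT g -> (forall x, `|g x| <= 1) ->
      (forall x, A x -> g x = c) -> (\int[mu]_x (L1_fun p x * g x))%R = c.
Proof.
move=> mA /andP[A0 Aoo]; have Afin : mu A \is a fin_num by rewrite ge0_fin_numE.
pose m := fine (mu A); have m0 : 0 < m by rewrite fine_gt0// A0.
have mAE : mu A = m%:E by rewrite fineK.
pose f x : R := m^-1 * \1_A x.
have mf : measurable_fun setT f by apply: measurable_funM => //; exact: measurable_indic.
have f0 x : 0 <= f x by rewrite mulr_ge0 ?invr_ge0 ?(ltW m0).
have iA : mu.-integrable setT (fun x => (\1_A x : R)%:E).
  apply/integrableP; split; first by apply/measurable_EFinP; exact: measurable_indic.
  rewrite (eq_integral (fun x => (\1_A x)%:E)) ?integral_indic// ?setIT// => x _.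
  by rewrite gee0_abs// lee_fin.
have intf c : (\int[mu]_x (c * f x)%:E = c%:E)%E.
  have -> : (fun x => (c * f x)%:E) = (fun x => (c / m)%:E * (\1_A x)%:E)%E.
    by apply/funext => x; rewrite -EFinM mulrA.
  rewrite integralZl//.
  by rewrite integral_indic// setIT mAE -EFinM divfK// gt_eqF.
have fi : mu.-integrable setT (EFin \o f).
  apply/integrableP; split; first exact/measurable_EFinP.
  rewrite (eq_integral (fun x => (1 * f x)%:E)) ?intf ?ltry// => x _.
  by rewrite mul1r /= ger0_norm.
have [p pf] := L1_of_integrable fi; have mp := L1_fun_measurable p.
exists p; split.
  rewrite -lee_fin L1_normE (ae_eq_integral (fun x => (1 * f x)%:E))//.
  - by rewrite intf.
  - by apply/measurable_EFinP; exact: measurableT_comp.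
  - by apply/measurable_EFinP; exact: measurable_funM.
  - by apply: filterS pf => x /(_ I) h _; rewrite h mul1r ger0_norm.
move=> g c mg g1 gc; rewrite (Rintegral_mul_ae_eq mg mp mf pf).
rewrite /Rintegral (eq_integral (fun x => (c * f x)%:E)) ?intf// => x _.
rewrite /f indicE; case: (boolP (x \in A)) => [/set_mem/gc ->|_];
  last by rewrite !mulr0 mul0r.
by rewrite mulrC.
Qed.

(** Riesz-Fischer: the sum [G] of the absolute values is integrable by monotone
    convergence, hence finite almost everywhere, and it dominates the partial
    sums.  The upper limit [F] is a version of their limit that is defined and
    measurable everywhere. *)
Lemma L1_absolutely_summable : absolutely_summable (L1 mu).
Proof.
move=> v cv; pose f n : T -> R := L1_fun (v n).
have mf n : measurable_fun setT (f n) by exact: L1_fun_measurable.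
pose G x := (\sum_(n <oo) `|f n x|%:E)%E.
have mfE n : measurable_fun setT (fun x => `|f n x|%:E).
  by apply/measurable_EFinP; exact: measurableT_comp.
have G0 x : (0 <= G x)%E by apply: nneseries_ge0 => n _ _; rewrite lee_fin.
have mG : measurable_fun setT G.
  by apply: ge0_emeasurable_sum => n *; [rewrite lee_fin|exact: mfE].
have Gi : mu.-integrable setT G.
  apply/integrableP; split => //.
  rewrite (eq_integral G); last by move=> x _; rewrite gee0_abs.
  rewrite integral_nneseries//.
  rewrite (eq_eseriesr (g := fun n => `|v n|%:E));
    last by move=> n _; rewrite L1_normE.
  have -> : (\sum_(n <oo) `|v n|%:E)%E = (limn [series `|v n|]_n)%:E.
    rewrite -EFin_lim//; congr (limn _); apply/funext => N.
    by rewrite /series/= sumEFin.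
  exact: ltry.
pose S N x := series (fun n => f n x) N.
have mS N : measurable_fun setT (S N).
  by rewrite /S /series/=; apply: measurable_sum.
have SG N x : (`|(S N x)%:E| <= G x)%E.
  apply: le_trans (nneseries_lim_ge N _); last by move=> n _ _; rewrite lee_fin.
  by rewrite sumEFin lee_fin; exact: ler_norm_sum.
pose F x := limn_esup (fun N => (S N x)%:E).
have mF : measurable_fun setT F.
  by apply: measurable_fun_limn_esup => N; exact/measurable_EFinP.
have SF : {ae mu, forall x, setT x -> (S N x)%:E @[N --> \oo] --> F x}.
  have := integrable_ae measurableT Gi; apply: filterS => x /(_ I) Gx _.
  have cx : cvgn (S ^~ x).
    apply: (@normed_cvg R R^o); apply: nondecreasing_is_cvgn.
      by apply: nondecreasing_series => n _ _; exact: normr_ge0.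
    exists (fine (G x)) => _ [N _ <-]; rewrite -lee_fin fineK//.
    apply: le_trans (nneseries_lim_ge N _); last by move=> n _ _; rewrite lee_fin.
    by rewrite sumEFin.
  have cEx : cvgn (fun N => (S N x)%:E).
    by apply/cvg_ex; exists (limn (S ^~ x))%:E; apply: cvg_EFin => //; exact: nearW.
  by rewrite /F is_cvg_limn_esupE.
have SGae : {ae mu, forall x N, setT x -> (`|(S N x)%:E| <= G x)%E}.
  by apply: aeW => x N _; exact: SG.
have [Fi D0 _] := @dominated_convergence _ _ _ mu setT measurableT
  (fun N x => (S N x)%:E) F G (fun N => (measurable_EFinP _ _).2 (mS N)) mF SF Gi SGae.
have FF : mu.-integrable setT (EFin \o (fine \o F)).
  apply: le_integrable Fi => //.
    by apply/measurable_EFinP; exact: measurableT_comp mF.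
  by move=> x _ /=; case: (F x) => [r| |]//=; rewrite normr0 leey.
have [p pF] := L1_of_integrable FF.
have SL N : (L1_fun (series v N) : T -> R) = S N %[ae mu].
  elim: N => [|N IH].
    rewrite /S /series/= big_geq//; apply: ae_eq_trans (L1_classK 0) _.
    by apply: aeW => x _; rewrite big_geq.
  have -> : series v N.+1 = 1 *: v N + series v N by rewrite seriesSr scale1r addrC.
  apply: ae_eq_trans (L1_funZD _ _ _) _.
  by apply: filterS IH => x /(_ I) h _; rewrite h mul1r /S seriesSr addrC.
have Ffin : {ae mu, forall x, setT x -> F x \is a fin_num} := integrable_ae measurableT Fi.
have normE N : (`|p - series v N|%:E = \int[mu]_x `|(S N x)%:E - F x|)%E.
  have -> : p - series v N = -1 *: series v N + p by rewrite scaleN1r addrC.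
  rewrite L1_normE; apply: ae_eq_integral => //.
  - apply/measurable_EFinP; apply: measurableT_comp => //; exact: L1_fun_measurable.
  - apply: measurableT_comp => //; apply: emeasurable_funB => //.
    exact/measurable_EFinP.
  - have := L1_funZD (-1) (series v N) p.
    have Sp : {ae mu, forall x, L1_fun (series v N) x = S N x /\
        L1_fun p x = fine (F x)}.
      by move: (SL N) pF; apply: filterS2 => x /(_ I) ? /(_ I).
    move: Sp Ffin; apply: filterS3 => x [h1 h2] /(_ I) Fx /(_ I) h _.
    by rewrite h h1 h2 /= mulN1r addrC distrC -[F x]fineK.
apply/cvg_ex; exists p; apply/cvgrPdist_lt => e e0.
have /fine_cvgP[_ /cvgrPdist_lt/(_ _ e0)] := D0.
apply: filterS => N /=; rewrite -normE /= sub0r normrN.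
by rewrite ger0_norm.
Qed.

End L1_space.

(** * A non-poor copy of l_1 in L_1 *)

(** Split a set of positive measure into two such sets, keep one of them and
    split the other again. *)
Lemma nonatomic_disjoint_sets d (T : measurableType d) (R : realType)
    (mu : {measure set T -> \bar R}) :
  nonatomic mu -> (0 < mu [set: T])%E ->
  exists E : nat -> set T,
    [/\ forall n, measurable (E n), forall n, (0 < mu (E n))%E & trivIset setT E].
Proof.
move=> nam muT.
have /choice[C CP] : forall B, exists C, measurable B -> (0 < mu B)%E ->
    [/\ measurable C, C `<=` B, (0 < mu C)%E & (0 < mu (B `\` C))%E].
  move=> B; have [mB|] := pselect (measurable B); last by exists set0.
  have [B0|] := pselect (0 < mu B)%E; last by exists set0.
  have : exists C, [/\ measurable C, C `<=` B & ~ (mu C = 0 \/ mu (B `\` C) = 0)].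
    apply: contra_notP (nam B) => noC; split=> // C mC CB.
    by apply: contrapT => h; apply: noC; exists C.
  move=> [C [mC CB /not_orP[C0 BC0]]]; exists C => _ _; split => //.
    by rewrite lt0e measure_ge0 andbT; exact/eqP.
  by rewrite lt0e measure_ge0 andbT; exact/eqP.
pose S n := iter n C setT.
have SP n : measurable (S n) /\ (0 < mu (S n))%E.
  elim: n => [|n [mS S0]]; first by split; [exact: measurableT|].
  by have [] := CP _ mS S0.
have SC n : [/\ S n.+1 `<=` S n & (0 < mu (S n `\` S n.+1))%E].
  by have [mS S0] := SP n; have [] := CP _ mS S0.
have Smono m n : (m <= n)%N -> S n `<=` S m.
  elim: n => [|n IH]; first by rewrite leqn0 => /eqP ->.
  rewrite leq_eqVlt => /orP[/eqP->//|/IH]; apply: subset_trans.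
  by have [] := SC n.
exists (fun n => S n `\` S n.+1); split=> [n|n|].
- by apply: measurableD; [have [] := SP n|have [] := SP n.+1].
- by have [] := SC n.
- apply: ltn_trivIset => n m nm; apply/seteqP; split => // x [[Snx nSx] [Smx _]].
  by apply: nSx; apply: Smono Smx.
Qed.

(** For signs th, the functional [psi] integrates against 1 on [E 0] and against
    the sign th n on [E n.+1]; it equals [phi + eta], where [eta] integrates
    over the sets [E n.+1] only.  As [phi + eta] and [phi - eta] both have norm
    at most one, |eta p| <= norm(p) - phi(p), which is at most 1/2 on the slice,
    whereas [eta] takes the value th n on [b n.+1]. *)
Theorem L1_nonpoor_l1_copy d (T : measurableType d) (R : realType)
    (mu : {finite_measure set T -> \bar R}) :
  nonatomic mu -> (0 < mu [set: T])%E -> separable (L1 mu) ->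
  exists Z : closedSubspace (L1 mu), isomorphic_to_subspace (l1 R) Z /\ ~ poor Z.
Proof.
move=> nam muT [S cS dS].
have [E [mE E0 tE]] := nonatomic_disjoint_sets nam muT.
have Efin n : (0 < mu (E n) < +oo)%E.
  by rewrite E0/= -ge0_fin_numE//; exact: fin_num_measure.
have /choice[b bP] : forall n, exists p : L1 mu, `|p| <= 1 /\
    forall (g : T -> R) c, measurable_fun setT g -> (forall x, `|g x| <= 1) ->
      (forall x, E n x -> g x = c) -> (\int[mu]_x (L1_fun p x * g x))%R = c.
  by move=> n; exact: (L1_bump (mE n) (Efin n)).
have Edisj m n x : m != n -> E m x -> ~ E n x.
  move=> mn Emx Enx; move/trivIsetP : tE => /(_ m n I I mn).
  by move/seteqP => [/(_ x) + _]; apply.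
have Eindic m n x : E n x -> \1_(E m) x = (m == n)%:R :> R.
  move=> Enx; rewrite indicE; have [->|mn] := eqVneq m n; first by rewrite mem_set.
  by rewrite memNset//; apply: contraPnot Enx; exact: Edisj.
pose g N (c : nat -> R) x := \sum_(m < N) c m * \1_(E m) x.
have gE N c n x : E n x -> g N c x = if (n < N)%N then c n else 0.
  move=> Enx; rewrite /g; case: ltnP => [nN|Nn].
    rewrite (bigD1 (Ordinal nN))//= (Eindic _ _ _ Enx) eqxx mulr1 big1 ?addr0// => m.
    by rewrite -val_eqE/= => /negPf mn; rewrite (Eindic _ _ _ Enx) mn mulr0.
  rewrite big1// => m _; rewrite (Eindic _ _ _ Enx) ltn_eqF ?mulr0//.
  exact: leq_trans (ltn_ord m) Nn.
have mg N c : measurable_fun setT (g N c).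
  apply: measurable_sum => m.
  by apply: measurable_funM => //; exact: measurable_indic.
have g1 N c : (forall m, `|c m| <= 1) -> forall x, `|g N c x| <= 1.
  move=> c1 x; have [[n Enx]|nE] := pselect (exists n, E n x).
    by rewrite (gE _ _ _ _ Enx); case: ifP => // _; rewrite normr0.
  rewrite /g big1 ?normr0// => m _; rewrite indicE memNset ?mulr0//.
  by move=> Emx; apply: nE; exists m.
have pair N c : (forall m, `|c m| <= 1) -> exists psi : {scalar L1 mu},
    [/\ forall p, psi p = (\int[mu]_x (L1_fun p x * g N c x))%R,
     forall p, `|psi p| <= `|p| &
     forall n, psi (b n) = if (n < N)%N then c n else 0].
  move=> c1; have [psi [psiE psi1]] := L1_pairing mu (mg N c) (g1 N c c1).
  exists psi; split => // n; rewrite psiE.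
  by have [_ bn] := bP n; apply: bn => //; [exact: g1|exact: gE].
have one1 (m : nat) : `|(m == 0)%:R : R| <= 1.
  by case: eqP => _; rewrite ?normr0 ?normr1.
have [phi [phiE phi1 phib]] := pair 1 (fun m => (m == 0)%:R) one1.
have [r rP] : exists r : nat -> L1 mu, forall p e, 0 < e -> exists n, `|p - r n| < e.
  have /countable_injP[k kinj] := cS.
  pose r n := if pselect (exists2 p, S p & k p = n) is left h
    then projT1 (cid2 h) else 0.
  exists r => p e e0; have [|q [pq Sq]] := dS (ball p e) _ (ball_open p e).
    by exists p; exact: ballxx.
  exists (k q); have -> : r (k q) = q.
    rewrite /r; case: pselect => [h|]; last by case; exists q.
    by case: cid2 => q' Sq' /= /kinj; apply; rewrite inE.
  by move: pq; rewrite -ball_normE.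
(* b 0 lies in the slice, hence may stand for the r n that do not *)
pose y n := if (`|r n| <= 5/4) && (3/4 <= phi (r n)) then r n else b 0.
have [y54 y34] : (forall n, `|y n| <= 5/4) /\ (forall n, `|y n| - phi (y n) <= 1/2).
  split=> n; rewrite /y; case: ifP => [/andP[]|_]; try lra.
    have := (bP 0).1; lra.
  have := (bP 0).1; rewrite phib/=; lra.
pose u n := y n - phi (y n) *: b 0 + b n.+1.
have b1 n : `|b n| <= 1 by have [] := bP n.
apply: (@nonpoor_l1_copy R (L1 mu) u (7/2) (1/2) phi (b 0)) => //.
- exact: L1_absolutely_summable.
- move=> n; apply: le_trans (ler_normD _ _) _.
  have := ler_normB (y n) (phi (y n) *: b 0); rewrite normrZ.
  have := ler_pM (normr_ge0 _) (normr_ge0 _) (phi1 (y n)) (b1 0).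
  have := y54 n; have := b1 n.+1; lra.
- move=> th N.
  pose c (e : R) m : R := if m is k.+1 then e * (-1) ^+ th k else 1.
  have c1 e : `|e| = 1 -> forall m, `|c e m| <= 1.
    by move=> e1 [|m]; rewrite /c ?normr1// normrM e1 normr_sign mulr1.
  have cp := c1 1 (normr1 _); have cm := c1 (-1) (normrN1 _).
  have [psi [psiE psi1 psib]] := pair N.+1 (c 1) cp.
  have [chi [chiE chi1 chib]] := pair N.+1 (c (-1)) cm.
  (* psi = phi + eta and chi = phi - eta *)
  have psichi p : psi p + chi p = phi p + phi p.
    rewrite psiE chiE phiE -!L1_pairingD//; [|exact: g1..].
    apply: eq_Rintegral => x _; congr (_ * _); rewrite /g !big_ord_recl !big_ord0/=.
    rewrite /bump/= !addr0 addrACA -big_split/= big1 ?addr0// => i _.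
    by rewrite mul1r mulN1r mulNr subrr.
  have [eta etaE] : exists eta : {scalar L1 mu},
      eta = (fun p => psi p - phi p) :> (_ -> _).
    apply: linear_bundle => a q1 q2; rewrite !linearD !scalarZ /=; ring.
  have etay (q : L1 mu) : `|eta q| <= `|q| - phi q.
    have := psichi q; have := psi1 q; have := chi1 q.
    rewrite etaE !ler_norml; lra.
  exists psi; split=> // i iN.
  have psib0 : psi (b 0) = 1 by rewrite psib.
  have psibi : psi (b i.+1) = (-1) ^+ th i by rewrite psib ltnS iN /c mul1r.
  have := le_trans (etay (y i)) (y34 i); rewrite etaE.
  rewrite linearD linearB scalarZ psib0 psibi mulr1.
  rewrite mulrDr -expr2 sqrr_sign.
  have := ler_norm (- ((-1) ^+ th i * (psi (y i) - phi (y i)))).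
  rewrite normrN normrM normr_sign mul1r; lra.
- by move=> n; rewrite linearD linearB scalarZ !phib/= mulr1 addr0 subrr.
move=> x x98 phix; have [n xn] := rP x (1/16) ltac:(lra); exists n.
have := ler_normB x (x - r n); rewrite subKr => rn.
have := le_trans (ler_norm _) (phi1 (x - r n)); rewrite linearB => phir.
have := ler_norm (- phi x); rewrite normrN => phixN.
have yn : y n = r n by rewrite /y ifT//; apply/andP; split; lra.
have -> : x - b 0 - u n = (x - r n) + ((phi (r n) - 1) *: b 0 - b n.+1).
  rewrite /u yn scalerBl scale1r opprD opprB -!addrA; congr (_ + _).
  by rewrite (addrCA (- b 0)) (addrCA (- r n)) (addrCA (- b 0)).
apply: le_trans (ler_normD _ _) _.
have := ler_normB ((phi (r n) - 1) *: b 0) (b n.+1); rewrite normrZ.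
have phir' : phi (r n) - phi x <= `|x - r n|.
  by rewrite distrC -linearB; exact: le_trans (ler_norm _) (phi1 _).
have p1 : `|phi (r n) - 1| <= 1/4.
  have := le_trans (ler_norm _) (phi1 x).
  rewrite ler_norml; lra.
have := ler_pM (normr_ge0 _) (normr_ge0 _) p1 (b1 0).
have := b1 n.+1; lra.
Qed.

Theorem theorem6p10 (R : realType) :
  (forall (K : metricType R) (cK : compact [set: K]),
     [set: K] !=set0 -> perfect_set [set: K] ->
     exists Z : closedSubspace (CK R cK),
       isomorphic_to_subspace (l1 R) Z /\ ~ poor Z) /\
  (forall (d : measure_display) (T : measurableType d)
     (mu : {finite_measure set T -> \bar R}),
     nonatomic mu -> (0 < mu [set: T])%E -> separable (L1 mu) ->
     exists Z : closedSubspace (L1 mu),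
       isomorphic_to_subspace (l1 R) Z /\ ~ poor Z).
Proof.
split; first by move=> K cK; exact: CK_metric_nonpoor_l1_copy.
by move=> d T mu; exact: L1_nonpoor_l1_copy.
Qed.
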